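(* There is an injective ring map $$\psi_T \colon K_T(X_{B_n})\to A^\bullet_T(X_{B_n})[\{ \textstyle\frac{1}{1-t_i},\frac{1}{1+t_i}\}_{1\le i \le n}]$$ given by $$(\psi_T(f))_w(t_1,\ldots,t_n)=f_w\left(\frac{1+t_1}{1-t_1},\ldots, \frac{1+t_n}{1-t_n}\right).$$ This map descends to a non-equivariant map $\psi \colon K(X_{B_n})\to A^\bullet(X_{B_n})$, which is injective and becomes an isomorphism after tensoring with $\mathbb Z[\frac{1}{2}]$. Moreover, $\psi_T$ and $\psi$ are $W$-equivariant: $\psi_T(w\cdot f)=w\cdot \psi_T(f)$ and $\psi(w\cdot f)=w\cdot \psi(f)$.
   Context: Let $k$ be an algebraically closed field, $T=(k^* )^n$, and $W$ the signed permutation group on $[n,\bar n]$. $X_{B_n}$ is the smooth projective toric variety of the type B permutohedral fan, whose maximal cones are $\sigma_w=\mathbb R_{\ge0}\{\mathbf e_{w(1)},\mathbf e_{w(1)}+\mathbf e_{w(2)},\dots,\mathbf e_{w(1)}+\dots+\mathbf e_{w(n)}\}$ for $w\in W$, with $\mathbf e_{\bar i}=-\mathbf e_i$. By localization, $K_T(X_{B_n})$ (resp. $A^\bullet_T(X_{B_n})$) is identified with tuples $(f_w)_{w\in W}$ of elements of $\mathbb Z[T_1^{\pm1},\dots,T_n^{\pm1}]$ (resp. $\mathbb Z[t_1,\dots,t_n]$) satisfying, for each edge $(w,w\tau)$ with $\tau\in\{(1,2),\dots,(n-1,n),(n,\bar n)\}$ and edge label $c=c(w,w\tau)$ equal to $\pm\mathbf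 e_{w(n)}$ for $\tau=(n,\bar n)$ and $\pm(\mathbf e_{w(i)}-\mathbf e_{w(i+1)})$ for $\tau=(i,i+1)$, the congruences $f_w-f_{w\tau}\equiv0\bmod (1-\prod_kT_k^{c_k})$ (resp. $\bmod \sum_k c_kt_k$). $K(X_{B_n})=K_T(X_{B_n})/(T_i-1)$ and $A^\bullet(X_{B_n})=A^\bullet_T(X_{B_n})/(t_i)$. $W$ acts by $(w\cdot f)_{w'}(T_1,\dots,T_n)=f_{w^{-1}w'}(T_{w(1)},\dots,T_{w(n)})$ with $T_{\bar i}=T_i^{-1}$, and similarly on $A^\bullet_T$ with $t_{\bar i}=-t_i$. *)

(* Defs.v *)
From HB Require Import structures.
From mathcomp Require Import all_boot all_order all_algebra all_fingroup.
From mathcomp Require Import generic_quotient ring_quotient fraction.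
From mathcomp Require Import boolp.
From mathcomp.multinomials Require Import freeg mpoly.

Set Implicit Arguments.
Unset Strict Implicit.
Unset Printing Implicit Defensive.

Import GRing.Theory.

Local Open Scope ring_scope.
Local Open Scope quotient_scope.

(* The element (i, false) is i and (i, true) is i-bar; indices start at 0. *)
Definition sgn (n : nat) : finType := ('I_n * bool)%type.

Definition bar n (x : sgn n) : sgn n := (x.1, ~~ x.2).

Definition sperm_set n : {set {perm sgn n}} :=
  [set w : {perm sgn n} | [forall x, w (bar x) == bar (w x)]].

Lemma sperm_setP n (w : {perm sgn n}) :
  reflect (forall x, w (bar x) = bar (w x)) (w \in sperm_set n).
Proof. by rewrite inE; apply: (iffP forallP) => h x; apply/eqP. Qed.

Lemma sperm_group_set n : group_set (sperm_set n).
Proof.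
apply/group_setP; split=> [|u v /sperm_setP hu /sperm_setP hv].
  by apply/sperm_setP => x; rewrite !perm1.
by apply/sperm_setP => x; rewrite !permM hu hv.
Qed.

Canonical sperm_group n := Group (@sperm_group_set n).

Definition sperm (n : nat) : finGroupType := subg_of (sperm_group n).

Definition sapp n (w : sperm n) (x : sgn n) : sgn n := sgval w x.

(* MathComp multiplies permutations from left to right, so that the composite
   "v first, then w" is the product v * w. *)
Definition scomp n (w v : sperm n) : sperm n := (v * w)%g.
Definition sinv n (w : sperm n) : sperm n := (w^-1)%g.

Lemma sapp_bar n (w : sperm n) x : sapp w (bar x) = bar (sapp w x).
Proof. by have /sperm_setP := subgP w; apply. Qed.

Lemma scompE n (w v : sperm n) x : sapp (scomp w v) x = sapp w (sapp v x).
Proof. by rewrite /sapp /scomp -permM. Qed.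

Lemma sinvK n (w : sperm n) x : sapp w (sapp (sinv w) x) = x.
Proof. by rewrite /sapp -permM -[(_ * _)%g]/(sgval (sinv w * w)%g) mulVg perm1. Qed.

Lemma sKinv n (w : sperm n) x : sapp (sinv w) (sapp w x) = x.
Proof. by rewrite /sapp -permM -[(_ * _)%g]/(sgval (w * sinv w)%g) mulgV perm1. Qed.

(* The edge directions are indexed by 'I_n: [insub i.+1 : option 'I_n] is the
   successor of i when there is one, which gives the transposition (i, i+1) of
   signed permutations; for the last index it is None, which gives (n, n-bar). *)
Definition tau_perm n (i : 'I_n) : {perm sgn n} :=
  if insub i.+1 is Some j then
    (tperm (i, false) (j, false) * tperm (i, true) (j, true))%g
  else tperm (i, false) (i, true).
Arguments tau_perm : clear implicits.

Lemma tau_permE n (i : 'I_n) x : tau_perm n i x =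
  if insub i.+1 is Some j then (tperm i j x.1, x.2)
  else (x.1, (x.1 == i) (+) x.2).
Proof.
case: x => k b; rewrite /tau_perm; case: insubP => [j _ ij|_] /=.
  have ji : (j == i) = false by apply/negbTE; rewrite -val_eqE ij /= gtn_eqF.
  rewrite permM !permE /= !xpair_eqE; case: b; rewrite ?andbF ?andbT /=.
    by rewrite !xpair_eqE ?andbT; case: eqVneq => // ?; case: eqVneq.
  by case: (eqVneq k i) => [?|?]; [|case: (eqVneq k j) => ?];
     rewrite /= !xpair_eqE ?andbF.
rewrite permE /= !xpair_eqE; case: b; rewrite ?andbF ?andbT /=;
by case: eqVneq => [->|].
Qed.

Lemma tau_perm_in n (i : 'I_n) : tau_perm n i \in sperm_group n.
Proof.
apply/sperm_setP => x; rewrite !tau_permE /bar; case: insubP => //= _.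
by rewrite addbN.
Qed.

Definition tau n (i : 'I_n) : sperm n := Subg (tau_perm_in i).

Definition evec n (x : sgn n) (k : 'I_n) : int :=
  if k == x.1 then (-1) ^+ x.2 else 0.

(* The label c(w, w tau_i); only c up to sign matters, and we choose the sign +. *)
Definition edge_label n (w : sperm n) (i k : 'I_n) : int :=
  if insub i.+1 is Some j then
    evec (sapp w (i, false)) k - evec (sapp w (j, false)) k
  else evec (sapp w (i, false)) k.

(* Rational functions in n variables; both Z[T_1^{+-1}, ..., T_n^{+-1}] and
   Z[t_1, ..., t_n] are regarded as subrings of this field. *)
Notation ratfun n := {fraction {mpoly int[n]}}.
Notation "x %:F" := (@FracField.tofrac _ x).

Definition laurent_pred n : {pred ratfun n} := fun f =>
  `[< exists (p : {mpoly int[n]}) (m : 'X_{1..n}), f = p%:F / ('X_[m])%:F >].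
Arguments laurent_pred : clear implicits.

Lemma mpolyX_neq0 n (m : 'X_{1..n}) : 'X_[m] != 0 :> {mpoly int[n]}.
Proof. by rewrite -msupp_eq0 msuppX. Qed.

Lemma mpolyXF_neq0 n (m : 'X_{1..n}) : ('X_[m])%:F != 0 :> ratfun n.
Proof. by rewrite tofrac_eq0 mpolyX_neq0. Qed.

Lemma laurent_fracB n (p q : {mpoly int[n]}) (m l : 'X_{1..n}) :
  p%:F / ('X_[m])%:F - q%:F / ('X_[l])%:F =
  (p * 'X_[l] - q * 'X_[m])%:F / ('X_[m + l])%:F.
Proof.
by rewrite mpolyXD -mulNr addf_div ?mpolyXF_neq0 // mulNr rmorphB !rmorphM.
Qed.

Lemma laurent_fracM n (p q : {mpoly int[n]}) (m l : 'X_{1..n}) :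
  p%:F / ('X_[m])%:F * (q%:F / ('X_[l])%:F) = (p * q)%:F / ('X_[m + l])%:F.
Proof. by rewrite mpolyXD !rmorphM /= mulf_div. Qed.

Lemma laurent_subring_closed n : subring_closed (laurent_pred n).
Proof.
split=> [|f g /asboolP[p [m ->]] /asboolP[q [l ->]]|
         f g /asboolP[p [m ->]] /asboolP[q [l ->]]]; apply/asboolP.
- by exists 1, 0%MM; rewrite mpolyX0 divr1.
- by exists (p * 'X_[l] - q * 'X_[m]), (m + l)%MM; rewrite laurent_fracB.
- by exists (p * q), (m + l)%MM; rewrite laurent_fracM.
Qed.

HB.instance Definition _ n :=
  GRing.isSubringClosed.Build _ (laurent_pred n) (@laurent_subring_closed n).

(* Z[T_1^{+-1}, ..., T_n^{+-1}] *)
Record laurent n := Laurent {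
  laurent_val :> ratfun n;
  laurentP : laurent_val \in laurent_pred n
}.
HB.instance Definition _ n := [isSub for @laurent_val n].
HB.instance Definition _ n := [Choice of laurent n by <:].
HB.instance Definition _ n := [SubChoice_isSubComNzRing of laurent n by <:].

Lemma laurent_fracP n (f : laurent n) :
  exists pm : {mpoly int[n]} * 'X_{1..n}, val f == pm.1%:F / ('X_[pm.2])%:F.
Proof. by case: f => f /= /asboolP[p [m ->]]; exists (p, m). Qed.

(* The value f(u) of a Laurent polynomial at a point u with nonzero
   coordinates; [leval_frac] shows that it does not depend on the chosen
   representation of f as a quotient. *)
Definition leval n (K : fieldType) (u : 'I_n -> K) (f : laurent n) : K :=
  let pm := xchoose (laurent_fracP f) in
  mmap intr u pm.1 / mmap1 u pm.2.

Section LaurentEvaluation.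
Variables (n : nat) (K : fieldType) (u : 'I_n -> K).
Hypothesis u_neq0 : forall i, u i != 0.

Lemma mmap1_neq0 m : mmap1 u m != 0.
Proof. by rewrite prodf_seq_neq0; apply/allP => i _; rewrite expf_neq0. Qed.

Lemma leval_frac (f : laurent n) p m :
  val f = p%:F / ('X_[m])%:F -> leval u f = mmap intr u p / mmap1 u m.
Proof.
rewrite /leval; have /eqP := xchooseP (laurent_fracP f).
set q := (xchoose _).1; set l := (xchoose _).2 => -> /eqP.
rewrite eqr_div ?mpolyXF_neq0 // -!rmorphM /= tofrac_eq => /eqP /(congr1 (mmap intr u)).
rewrite !rmorphM /= !mmapX => e.
by apply/eqP; rewrite eqr_div ?mmap1_neq0 //; apply/eqP.
Qed.

Lemma leval_is_zmod_morphism : zmod_morphism (leval u).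
Proof.
move=> f g; have [p [m ef]] := asboolP _ (laurentP f).
have [q [l eg]] := asboolP _ (laurentP g).
rewrite (leval_frac ef) (leval_frac eg).
rewrite (@leval_frac _ (p * 'X_[l] - q * 'X_[m]) (m + l)%MM); last first.
  by rewrite rmorphB /= ef eg laurent_fracB.
rewrite commr_mmap1_M; last by move=> *; apply: mulrC.
by rewrite -[in RHS]mulNr [RHS]addf_div ?mmap1_neq0 // mulNr rmorphB !rmorphM /= !mmapX.
Qed.

Lemma leval_is_monoid_morphism : monoid_morphism (leval u).
Proof.
split=> [|f g].
  rewrite (@leval_frac _ 1 0%MM) ?rmorph1 ?mmap11 ?divr1 //.
  by rewrite mpolyX0 rmorph1 divr1.
have [p [m ef]] := asboolP _ (laurentP f).
have [q [l eg]] := asboolP _ (laurentP g).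
rewrite (leval_frac ef) (leval_frac eg).
rewrite (@leval_frac _ (p * q) (m + l)%MM); last first.
  by rewrite rmorphM /= ef eg laurent_fracM.
rewrite commr_mmap1_M; last by move=> *; apply: mulrC.
by rewrite mulf_div rmorphM.
Qed.
End LaurentEvaluation.

(* T_x for x in [n, n-bar], with T_{i-bar} = T_i^-1. *)
Definition Tsgn n (x : sgn n) : ratfun n :=
  if x.2 then (('X_x.1)%:F)^-1 else ('X_x.1)%:F.

Lemma Tvar_neq0 n (i : 'I_n) : ('X_i)%:F != 0 :> ratfun n.
Proof. exact: mpolyXF_neq0. Qed.

Lemma Tsgn_neq0 n (x : sgn n) : Tsgn x != 0.
Proof. by rewrite /Tsgn; case: x.2; rewrite ?invr_eq0 Tvar_neq0. Qed.

Lemma Tsgn_bar n (x : sgn n) : Tsgn (bar x) = (Tsgn x)^-1.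
Proof. by rewrite /Tsgn /bar /=; case: x.2 => //=; rewrite invrK. Qed.

Lemma Tsgn_laurent n (x : sgn n) : Tsgn x \in laurent_pred n.
Proof.
apply/asboolP; rewrite /Tsgn; case: x.2.
  by exists 1, U_(x.1)%MM; rewrite rmorph1 div1r.
by exists 'X_(x.1), 0%MM; rewrite mpolyX0 rmorph1 divr1.
Qed.

Lemma lmon_subproof n (c : 'I_n -> int) :
  \prod_k ('X_k)%:F ^ c k \in laurent_pred n.
Proof.
apply: rpred_prod => k _.
have -> : ('X_k)%:F = Tsgn (k, false) by [].
case: (c k) => m; first by rewrite -exprnP rpredX // Tsgn_laurent.
by rewrite NegzE -exprnN -exprVn -Tsgn_bar rpredX // Tsgn_laurent.
Qed.

(* prod_k T_k^(c_k) *)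
Definition lmon n (c : 'I_n -> int) : laurent n := Laurent (lmon_subproof c).

Lemma lact_subproof n (w : sperm n) (f : laurent n) :
  leval (fun i => Tsgn (sapp w (i, false))) f \in laurent_pred n.
Proof.
have [p [m ef]] := asboolP _ (laurentP f).
rewrite (leval_frac _ ef) => [|i]; last exact: Tsgn_neq0.
rewrite rpredM //.
  rewrite rpred_sum // => l _; rewrite rpredM ?rpred_int //.
  by apply: rpred_prod => i _; rewrite rpredX ?Tsgn_laurent.
rewrite /mmap1 -prodfV; apply: rpred_prod => i _.
by rewrite -exprVn -Tsgn_bar rpredX ?Tsgn_laurent.
Qed.

(* f(T_{w(1)}, ..., T_{w(n)}) *)
Definition lact n (w : sperm n) (f : laurent n) : laurent n :=
  Laurent (lact_subproof w f).

Lemma lact_is_zmod_morphism n (w : sperm n) : zmod_morphism (lact w).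
Proof.
move=> f g; apply/val_inj; rewrite rmorphB /=.
by apply: leval_is_zmod_morphism => i; apply: Tsgn_neq0.
Qed.

Lemma lact_is_monoid_morphism n (w : sperm n) : monoid_morphism (lact w).
Proof.
have [h1 hM] := leval_is_monoid_morphism
  (fun i => Tsgn_neq0 (sapp w (i, false))).
split=> [|f g]; apply/val_inj; first by rewrite rmorph1 /= h1.
by rewrite rmorphM /= hM.
Qed.

HB.instance Definition _ n (w : sperm n) :=
  GRing.isZmodMorphism.Build _ _ (lact w) (lact_is_zmod_morphism w).
HB.instance Definition _ n (w : sperm n) :=
  GRing.isMonoidMorphism.Build _ _ (lact w) (lact_is_monoid_morphism w).

(* t_x for x in [n, n-bar], with t_{i-bar} = - t_i. *)
Definition tsgn n (x : sgn n) : {mpoly int[n]} :=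
  if x.2 then - 'X_x.1 else 'X_x.1.

Lemma tsgn_bar n (x : sgn n) : tsgn (bar x) = - tsgn x.
Proof. by rewrite /tsgn /bar /=; case: x.2 => //=; rewrite opprK. Qed.

(* p(t_{w(1)}, ..., t_{w(n)}) *)
Definition tact n (w : sperm n) (p : {mpoly int[n]}) : {mpoly int[n]} :=
  p \mPo [tuple tsgn (sapp w (i, false)) | i < n].

HB.instance Definition _ n (w : sperm n) :=
  GRing.RMorphism.copy (tact w)
    (comp_mpoly [tuple tsgn (sapp w (i, false)) | i < n]).

Lemma tact_tsgn n (w : sperm n) x : tact w (tsgn x) = tsgn (sapp w x).
Proof.
have tactX i : tact w 'X_i = tsgn (sapp w (i, false)).
  by rewrite /tact comp_mpolyXU -tnth_nth tnth_mktuple.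
case: x => i b; rewrite /tsgn /=; case: b => /=; last exact: tactX.
by rewrite rmorphN /= tactX -[(i, true)]/(bar (i, false)) sapp_bar -tsgn_bar.
Qed.

Section GKM.
Variables (n : nat) (R : comNzRingType) (lab : sperm n -> 'I_n -> R).

Definition gkm_pred : {pred {ffun sperm n -> R}} := fun f =>
  `[< forall (w : sperm n) (i : 'I_n),
        exists g, f w - f (scomp w (tau i)) = lab w i * g >].

Lemma gkm_subring_closed : subring_closed gkm_pred.
Proof.
split=> [|f g /asboolP hf /asboolP hg|f g /asboolP hf /asboolP hg];
  apply/asboolP => w i.
- by exists 0; rewrite !ffunE subrr mulr0.
- have [[a ea] [b eb]] := (hf w i, hg w i); exists (a - b).
  by rewrite !ffunE mulrBr -ea -eb !opprD !opprK addrACA.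
- have [[a ea] [b eb]] := (hf w i, hg w i).
  exists (a * g w + f (scomp w (tau i)) * b).
  rewrite !ffunE mulrDr mulrA -ea mulrCA -eb mulrBl mulrBr.
  by rewrite addrA subrK.
Qed.

HB.instance Definition _ :=
  GRing.isSubringClosed.Build _ gkm_pred gkm_subring_closed.

Record gkm := GKM {
  gkm_val :> {ffun sperm n -> R};
  gkmP : gkm_val \in gkm_pred
}.
HB.instance Definition _ := [isSub for gkm_val].
HB.instance Definition _ := [Choice of gkm by <:].
HB.instance Definition _ := 
  GRing.SubChoice_isSubPzRing.Build _ gkm_pred gkm gkm_subring_closed.

Lemma gkm_mulC : commutative (@GRing.mul gkm).
Proof.
by move=> f g; apply/val_inj; rewrite !rmorphM; apply/ffunP => w; rewrite !ffunE mulrC.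
Qed.

Lemma gkm_oner_neq0 : 1 != 0 :> gkm.
Proof.
apply/eqP => /(congr1 (fun f : gkm => f 1%g)) /=; rewrite !ffunE.
by move/eqP; rewrite oner_eq0.
Qed.

HB.instance Definition _ := GRing.PzRing_hasCommutativeMul.Build gkm gkm_mulC.
HB.instance Definition _ :=
  GRing.PzSemiRing_isNonZero.Build gkm gkm_oner_neq0.

Lemma gkm_const_subproof (x : R) : [ffun=> x] \in gkm_pred.
Proof. by apply/asboolP => w i; exists 0; rewrite !ffunE subrr mulr0. Qed.

Definition gkm_const (x : R) : gkm := GKM (gkm_const_subproof x).

Section Action.
Variable rho : sperm n -> {rmorphism R -> R}.
Hypothesis rho_lab : forall w v i, rho w (lab v i) = lab (scomp w v) i.

Lemma gkm_act_subproof w (f : gkm) :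
  [ffun v => rho w (f (scomp (sinv w) v))] \in gkm_pred.
Proof.
apply/asboolP => v i; rewrite !ffunE.
have /asboolP/(_ (scomp (sinv w) v) i)[g eg] := gkmP f.
exists (rho w g); rewrite -rmorphB.
have -> : scomp (sinv w) (scomp v (tau i)) = scomp (scomp (sinv w) v) (tau i).
  by rewrite /scomp mulgA.
by rewrite eg rmorphM rho_lab /scomp /sinv mulgKV.
Qed.

Definition gkm_act w (f : gkm) : gkm := GKM (gkm_act_subproof w f).
End Action.
End GKM.


Section EdgeLabels.
Variables (n : nat) (K : fieldType) (u : 'I_n -> K).
Hypothesis u_neq0 : forall i, u i != 0.

Let U (x : sgn n) : K := if x.2 then (u x.1)^-1 else u x.1.

Lemma leval_lmon (c : 'I_n -> int) : leval u (lmon c) = \prod_k u k ^ c k.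
Proof.
have Pp k (z : int) : ('X_k)%:F ^ z \in laurent_pred n.
  have -> : ('X_k)%:F = Tsgn (k, false) by [].
  case: z => m; first by rewrite -exprnP rpredX // Tsgn_laurent.
  by rewrite NegzE -exprnN -exprVn -Tsgn_bar rpredX // Tsgn_laurent.
have eP k (z : int) : leval u (Laurent (Pp k z)) = u k ^ z.
  case: z => m.
    rewrite (@leval_frac _ _ u u_neq0 _ ('X_k ^+ m) 0%MM) ?mpolyX0 ?rmorph1 ?divr1 /=.
      by rewrite mmap11 divr1 rmorphXn /= mmapX mmap1U.
    by rewrite -exprnP rmorphXn.
  rewrite (@leval_frac _ _ u u_neq0 _ 1 (U_(k) *+ m.+1)%MM) /=.
    have -> : mmap1 u (U_(k) *+ m.+1)%MM = mmap intr u 'X_[(U_(k) *+ m.+1)] by rewrite mmapX.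
    by rewrite rmorph1 div1r NegzE -exprnN -mpolyXn rmorphXn /= mmapX mmap1U.
  by rewrite rmorph1 div1r NegzE -exprnN -mpolyXn rmorphXn.
have [h1 hM] := leval_is_monoid_morphism u_neq0.
pose ev : laurent n -> K := leval u.
have -> : lmon c = \prod_k Laurent (Pp k (c k)).
  by apply/val_inj; rewrite rmorph_prod.
rewrite (big_morph (leval u) hM h1).
by apply: eq_bigr => k _; rewrite eP.
Qed.

Lemma prod_evec (x : sgn n) : \prod_k u k ^ evec x k = U x.
Proof.
rewrite (bigD1 x.1) //= [X in _ * X]big1 ?mulr1 => [|k /negbTE kx].
  by rewrite /evec eqxx /U; case: x.2; rewrite ?expr0 ?expr1 ?expr1z // exprN1.
by rewrite /evec kx expr0z.
Qed.

Lemma prod_edge_label (w : sperm n) (i : 'I_n) :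
  \prod_k u k ^ edge_label w i k =
  if insub i.+1 is Some j then U (sapp w (i, false)) / U (sapp w (j, false))
  else U (sapp w (i, false)).
Proof.
rewrite /edge_label; case: insub => [j|]; rewrite -!prod_evec // -prodfV.
rewrite -big_split; apply: eq_bigr => k _ /=.
by rewrite expfzDr // invr_expz.
Qed.

End EdgeLabels.

Definition labelK n (w : sperm n) (i : 'I_n) : laurent n :=
  1 - lmon (edge_label w i).

Definition labelA n (w : sperm n) (i : 'I_n) : {mpoly int[n]} :=
  \sum_k edge_label w i k *: 'X_k.

Lemma lact_labelK n (w v : sperm n) (i : 'I_n) :
  lact w (labelK v i) = labelK (scomp w v) i.
Proof.
rewrite /labelK rmorphB rmorph1; congr (_ - _); apply/val_inj => /=.
rewrite leval_lmon => [|k]; last exact: Tsgn_neq0.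
rewrite prod_edge_label => [|k]; last exact: Tsgn_neq0.
rewrite prod_edge_label => [|k]; last exact: Tvar_neq0.
have aux x : (if x.2 then (Tsgn (sapp w (x.1, false)))^-1
              else Tsgn (sapp w (x.1, false))) = Tsgn (sapp w x).
  by case: x => k [] //=; rewrite -Tsgn_bar -sapp_bar.
by case: insub => [j|]; rewrite !aux -!scompE.
Qed.

Lemma labelAE n (w : sperm n) (i : 'I_n) : labelA w i =
  if insub i.+1 is Some j then tsgn (sapp w (i, false)) - tsgn (sapp w (j, false))
  else tsgn (sapp w (i, false)).
Proof.
have aux x : \sum_k evec x k *: 'X_k = tsgn x.
  rewrite (bigD1 x.1) //= big1 ?addr0 => [|k /negbTE kx].
    by rewrite /evec eqxx /tsgn; case: x.2; rewrite ?expr1 ?scaleN1r ?expr0 ?scale1r.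
  by rewrite /evec kx scale0r.
rewrite /labelA /edge_label; case: insub => [j|]; rewrite -!aux // -sumrB.
by apply: eq_bigr => k _; rewrite scalerBl.
Qed.

Lemma tact_labelA n (w v : sperm n) (i : 'I_n) :
  tact w (labelA v i) = labelA (scomp w v) i.
Proof.
by rewrite !labelAE; case: insub => [j|]; rewrite ?rmorphB /= !tact_tsgn !scompE.
Qed.

(* K_T(X_{B_n}) and A_T(X_{B_n}) in their description by localization at the
   torus-fixed points, which are indexed by the signed permutations; the ground
   field plays no role in this description. *)
Notation KT n := (gkm (@labelK n)).
Notation AT n := (gkm (@labelA n)).

(* (w . f)_v (T_1, ..., T_n) = f_{w^-1 v} (T_{w(1)}, ..., T_{w(n)}) *)
Definition KT_act n (w : sperm n) (f : KT n) : KT n :=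
  gkm_act (@lact_labelK n) w f.
Definition AT_act n (w : sperm n) (f : AT n) : AT n :=
  gkm_act (@tact_labelA n) w f.


Section ActionMorphism.
Variables (n : nat) (R : comNzRingType) (lab : sperm n -> 'I_n -> R).
Variable rho : sperm n -> {rmorphism R -> R}.
Hypothesis rho_lab : forall w v i, rho w (lab v i) = lab (scomp w v) i.

Lemma gkm_act_is_zmod_morphism w : zmod_morphism (gkm_act rho_lab w).
Proof.
by move=> f g; apply/val_inj/ffunP => v; rewrite !ffunE rmorphB.
Qed.

Lemma gkm_act_is_monoid_morphism w : monoid_morphism (gkm_act rho_lab w).
Proof.
split=> [|f g]; apply/val_inj/ffunP => v; rewrite !ffunE ?rmorph1 //.
by rewrite rmorphM.
Qed.

HB.instance Definition _ w := GRing.isZmodMorphism.Build _ _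
  (gkm_act rho_lab w) (gkm_act_is_zmod_morphism w).
HB.instance Definition _ w := GRing.isMonoidMorphism.Build _ _
  (gkm_act rho_lab w) (gkm_act_is_monoid_morphism w).

Lemma gkm_act_const w x :
  gkm_act rho_lab w (gkm_const lab x) = gkm_const lab (rho w x).
Proof. by apply/val_inj/ffunP => v; rewrite !ffunE. Qed.
End ActionMorphism.

HB.instance Definition _ n (w : sperm n) :=
  GRing.RMorphism.copy (KT_act w) (gkm_act (@lact_labelK n) w).
HB.instance Definition _ n (w : sperm n) :=
  GRing.RMorphism.copy (AT_act w) (gkm_act (@tact_labelA n) w).

Definition ideal_gen (A : comNzRingType) m (x : 'I_m -> A) : {pred A} :=
  fun y => `[< exists a : 'I_m -> A, y = \sum_i a i * x i >].

Section IdealGen.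
Variables (A : comNzRingType) (m : nat) (x : 'I_m -> A).

Lemma ideal_gen_gen i : x i \in ideal_gen x.
Proof.
apply/asboolP; exists (fun j => (j == i)%:R).
rewrite (bigD1 i) //= eqxx mul1r big1 ?addr0 // => j /negbTE->.
by rewrite mul0r.
Qed.

Lemma ideal_gen_closed : 1 \notin ideal_gen x -> idealr_closed (ideal_gen x).
Proof.
move=> x1; split=> //; first apply/asboolP.
  by exists (fun=> 0); rewrite big1 // => i _; rewrite mul0r.
move=> c u v /asboolP[a ->] /asboolP[b ->]; apply/asboolP.
exists (fun i => c * a i + b i); rewrite mulr_sumr -big_split.
by apply: eq_bigr => i _; rewrite /= mulrDl mulrA.
Qed.

Lemma ideal_gen_proper (B : nzRingType) (phi : {rmorphism A -> B}) :
  (forall i, phi (x i) = 0) -> 1 \notin ideal_gen x.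
Proof.
move=> phix; apply/asboolP => -[a /(congr1 phi)]; rewrite rmorph1 rmorph_sum.
rewrite big1 => [/eqP|i _]; first by rewrite oner_eq0.
by rewrite rmorphM phix mulr0.
Qed.

Lemma ideal_gen_stable (phi : {rmorphism A -> A}) (I : idealr A) :
  (I : pred A) =1 ideal_gen x -> (forall i, phi (x i) \in I) ->
  forall y, y \in I -> phi y \in I.
Proof.
move=> eI phix y yI; have /asboolP[a ->] : ideal_gen x y by rewrite -eI.
by rewrite rmorph_sum rpred_sum // => i _; rewrite rmorphM idealMr.
Qed.
End IdealGen.

Definition Tvar n (i : 'I_n) : laurent n := Laurent (Tsgn_laurent (i, false)).

(* (T_1 - 1, ..., T_n - 1) and (t_1, ..., t_n) *)
Definition KT_ideal n : {pred KT n} :=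
  ideal_gen (fun i : 'I_n => gkm_const (@labelK n) (Tvar i - 1)).
Definition AT_ideal n : {pred AT n} :=
  ideal_gen (fun i : 'I_n => gkm_const (@labelA n) 'X_i).

Section Augmentations.
Variable n : nat.

Definition eval1K (f : KT n) : rat := leval (fun=> 1) (f 1%g).
Definition eval0A (f : AT n) : int := (f 1%g).@[fun=> 0].

Lemma eval1K_is_zmod_morphism : zmod_morphism eval1K.
Proof.
move=> f g; rewrite /eval1K /= !ffunE.
by apply: leval_is_zmod_morphism => i; apply: oner_neq0.
Qed.

Lemma eval1K_is_monoid_morphism : monoid_morphism eval1K.
Proof.
have [h1 hM] := @leval_is_monoid_morphism n rat (fun=> 1) (fun=> oner_neq0 _).
by split=> [|f g]; rewrite /eval1K /= !ffunE ?h1 ?hM.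
Qed.

Lemma eval0A_is_zmod_morphism : zmod_morphism eval0A.
Proof. by move=> f g; rewrite /eval0A /= !ffunE mevalB. Qed.

Lemma eval0A_is_monoid_morphism : monoid_morphism eval0A.
Proof. by split=> [|f g]; rewrite /eval0A /= !ffunE ?meval1 ?mevalM. Qed.

HB.instance Definition _ :=
  GRing.isZmodMorphism.Build _ _ eval1K eval1K_is_zmod_morphism.
HB.instance Definition _ :=
  GRing.isMonoidMorphism.Build _ _ eval1K eval1K_is_monoid_morphism.
HB.instance Definition _ :=
  GRing.isZmodMorphism.Build _ _ eval0A eval0A_is_zmod_morphism.
HB.instance Definition _ :=
  GRing.isMonoidMorphism.Build _ _ eval0A eval0A_is_monoid_morphism.

Lemma KT_ideal_closed : idealr_closed (@KT_ideal n).
Proof.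
apply/ideal_gen_closed/(@ideal_gen_proper _ _ _ _ eval1K) => i.
have h1 (j : 'I_n) : (fun=> 1 : rat) j != 0 by apply: oner_neq0.
rewrite /= /eval1K /= ffunE (leval_is_zmod_morphism h1).
rewrite (leval_is_monoid_morphism h1).1.
rewrite (@leval_frac _ _ _ h1 _ 'X_i 0%MM) /=.
  by rewrite mmapX mmap1U mmap11 divr1 subrr.
by rewrite mpolyX0 rmorph1 divr1.
Qed.

Lemma AT_ideal_closed : idealr_closed (@AT_ideal n).
Proof.
apply/ideal_gen_closed/(@ideal_gen_proper _ _ _ _ eval0A) => i.
by rewrite /= /eval0A /= ffunE mevalXU.
Qed.
End Augmentations.

HB.instance Definition _ n :=
  isIdealr.Build (KT n) (@KT_ideal n) (@KT_ideal_closed n).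
HB.instance Definition _ n :=
  isIdealr.Build (AT n) (@AT_ideal n) (@AT_ideal_closed n).

(* K(X_{B_n}) and A(X_{B_n}) *)
Notation KX n := {ideal_quot (@KT_ideal n)}.
Notation AX n := {ideal_quot (@AT_ideal n)}.

(* See [KX_act_pi] and [AX_act_pi]: these are the induced actions. *)
Definition KX_act n (w : sperm n) (x : KX n) : KX n :=
  \pi_(KX n) (KT_act w (repr x)).
Definition AX_act n (w : sperm n) (x : AX n) : AX n :=
  \pi_(AX n) (AT_act w (repr x)).

Section QuotientAction.
Variables (n : nat) (w : sperm n).

Lemma KT_act_ideal f : f \in @KT_ideal n -> KT_act w f \in @KT_ideal n.
Proof.
apply: (@ideal_gen_stable _ _ _ (KT_act w) (@KT_ideal n)) => // i.
rewrite /= /KT_act gkm_act_const /=.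
have -> : lact w (Tvar i - 1) = Laurent (Tsgn_laurent (sapp w (i, false))) - 1.
  rewrite rmorphB rmorph1; congr (_ - _); apply/val_inj => /=.
  rewrite (@leval_frac _ _ _ _ _ 'X_i 0%MM) /=.
  - by rewrite mmapX mmap1U mmap11 divr1.
  - by move=> j; apply: Tsgn_neq0.
  - by rewrite mpolyX0 rmorph1 divr1.
case: (sapp w (i, false)) => j b.
have hj := ideal_gen_gen (fun i => gkm_const (@labelK n) (Tvar i - 1)) j.
case: b; last by have -> : Laurent (Tsgn_laurent (j, false)) = Tvar j.
have -> : gkm_const (@labelK n) (Laurent (Tsgn_laurent (j, true)) - 1) =
  - gkm_const (@labelK n) (Laurent (Tsgn_laurent (j, true))) *
    gkm_const (@labelK n) (Tvar j - 1).
  apply/val_inj/ffunP => v; rewrite !ffunE; apply/val_inj => /=.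
  rewrite /Tsgn /= mulNr mulrBr mulr1 mulVf ?Tvar_neq0 //.
  by rewrite opprB.
exact: (@idealMr _ (@KT_ideal n)).
Qed.

Lemma AT_act_ideal f : f \in @AT_ideal n -> AT_act w f \in @AT_ideal n.
Proof.
apply: (@ideal_gen_stable _ _ _ (AT_act w) (@AT_ideal n)) => // i.
rewrite /= /AT_act gkm_act_const /= -[X in tact w X]/(tsgn (i, false)) tact_tsgn.
case: (sapp w (i, false)) => j b.
have hj := ideal_gen_gen (fun i => gkm_const (@labelA n) 'X_i) j.
case: b => //.
have -> : gkm_const (@labelA n) (tsgn (j, true)) = - gkm_const (@labelA n) 'X_j.
  by apply/val_inj/ffunP => v; rewrite !ffunE.
by rewrite rpredN.
Qed.

Lemma KX_act_pi (f : KT n) : KX_act w (\pi_(KX n) f) = \pi_(KX n) (KT_act w f).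
Proof.
apply/eqP; rewrite -Quotient.idealrBE -rmorphB KT_act_ideal //.
by rewrite Quotient.idealrBE reprK.
Qed.

Lemma AX_act_pi (f : AT n) : AX_act w (\pi_(AX n) f) = \pi_(AX n) (AT_act w f).
Proof.
apply/eqP; rewrite -Quotient.idealrBE -rmorphB AT_act_ideal //.
by rewrite Quotient.idealrBE reprK.
Qed.
End QuotientAction.

Lemma mpoly_rmorph_ext n (S : nzRingType) (f g : {rmorphism {mpoly int[n]} -> S}) :
  (forall i, f 'X_i = g 'X_i) -> f =1 g.
Proof.
move=> fg p; rewrite (mpolyE p) !rmorph_sum; apply: eq_bigr => m _.
rewrite -mul_mpolyC !rmorphM /=; congr (_ * _).
  by rewrite -[p@_m]intz (rmorph_int (@mpolyC n int)) !rmorph_int.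
rewrite (mpolyXE_id _ m) !rmorph_prod; apply: eq_bigr => i _.
by rewrite !rmorphXn fg.
Qed.

Lemma tact_comp n (w v : sperm n) p : tact w (tact v p) = tact (scomp w v) p.
Proof.
apply: (mpoly_rmorph_ext (f := tact w \o tact v) (g := tact (scomp w v))) => i.
have tactX u : tact u 'X_i = tsgn (sapp u (i, false)) :> {mpoly int[n]}.
  exact: (tact_tsgn u (i, false)).
by rewrite /= !tactX tact_tsgn -scompE.
Qed.

Lemma tact1 n (w : sperm n) p : w = 1%g -> tact w p = p.
Proof.
move=> ->; rewrite /tact -[RHS]comp_mpoly_id; congr (_ \mPo _).
by apply: eq_from_tnth => i; rewrite !tnth_mktuple /sapp perm1.
Qed.

Lemma tact_inj n (w : sperm n) : injective (tact w).
Proof.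
apply: (can_inj (g := tact (sinv w))) => p.
by rewrite tact_comp tact1 // /scomp mulgV.
Qed.

(* g(t_{w(1)}, ..., t_{w(n)}) for a rational function g; see [ract_frac]. *)
Definition ract n (w : sperm n) (g : ratfun n) : ratfun n :=
  (tact w \n_(repr g))%:F / (tact w \d_(repr g))%:F.

Lemma frac_repr (R : idomainType) (g : {fraction R}) :
  g = (\n_(repr g))%:F / (\d_(repr g))%:F.
Proof.
set r := repr g; have d0 : (\d_r)%:F != 0 :> {fraction R}.
  by rewrite tofrac_eq0 denom_ratioP.
apply: (mulIf d0); rewrite divfK //.
rewrite -[g]reprK -/r; move: r d0 => r _.
have -> : (\d_r)%:F = \pi_(FracField.type R) (Ratio \d_r 1) :> {fraction R} by rewrite piE.
have -> : (\n_r)%:F = \pi_(FracField.type R) (Ratio \n_r 1) :> {fraction R} by rewrite piE.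
rewrite -[LHS]/(FracField.mul _ _) -FracField.pi_mul.
apply/eqmodP; rewrite /= FracField.equivfE /FracField.mulf.
rewrite !numden_Ratio ?mulf_neq0 ?denom_ratioP ?oner_eq0 //.
by rewrite !mulr1 mulrC.
Qed.

Lemma ract_frac n (w : sperm n) (p q : {mpoly int[n]}) :
  q != 0 -> ract w (p%:F / q%:F) = (tact w p)%:F / (tact w q)%:F.
Proof.
move=> q0; set g := p%:F / q%:F.
have tactF_neq0 (d : {mpoly int[n]}) : d != 0 -> (tact w d)%:F != 0 :> ratfun n.
  move=> d0; rewrite tofrac_eq0; apply: contra_neq d0 => d0.
  by apply: (@tact_inj _ w); rewrite d0 rmorph0.
have d0 := denom_ratioP (repr g).
have e : \n_(repr g) * q = p * \d_(repr g).
  apply/eqP; rewrite -tofrac_eq !rmorphM /=.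
  by rewrite -eqr_div ?tofrac_eq0 // -frac_repr.
apply/eqP; rewrite /ract eqr_div ?tactF_neq0 //.
by rewrite -!(rmorphM (@FracField.tofrac _)) -!(rmorphM (tact w)) e.
Qed.

(* The monomials prod_i (1 - t_i)^(a_i) (1 + t_i)^(b_i), with a_i = k (i, false)
   and b_i = k (i, true). *)
Definition locden n (k : sgn n -> nat) : {mpoly int[n]} :=
  \prod_x (1 - tsgn x) ^+ k x.

Lemma locden_neq0 n (k : sgn n -> nat) : locden k != 0.
Proof.
apply/prodf_neq0 => x _; rewrite expf_neq0 //.
apply/eqP => /(congr1 (meval (fun=> 0))); rewrite mevalB meval1 meval0.
suff -> : (tsgn x).@[fun=> 0] = 0 by rewrite subr0 => /eqP; rewrite oner_eq0.
by rewrite /tsgn; case: x.2; rewrite ?mevalN mevalXU ?oppr0.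
Qed.

Lemma locdenD n (k l : sgn n -> nat) :
  locden (fun x => k x + l x)%N = locden k * locden l.
Proof. by rewrite /locden -big_split; apply: eq_bigr => x _; rewrite exprD. Qed.

Lemma tact_locden n (w : sperm n) (k : sgn n -> nat) :
  tact w (locden k) = locden (k \o sapp (sinv w)).
Proof.
rewrite /locden [RHS](reindex_inj (h := sapp w)) /=; last first.
  exact: can_inj (sKinv w).
rewrite (rmorph_prod (tact w)); apply: eq_bigr => x _.
by rewrite (rmorphXn (tact w)) rmorphB rmorph1 /= tact_tsgn sKinv.
Qed.

(* A_T(X_{B_n})[{1/(1 - t_i), 1/(1 + t_i)}]; as the 1 - t_i and 1 + t_i are not
   zero divisors, this localization is a ring of tuples of rational functions. *)
Definition ATloc_pred n : {pred {ffun sperm n -> ratfun n}} := fun g =>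
  `[< exists (a : AT n) (k : sgn n -> nat),
        forall w, g w = (a w)%:F / (locden k)%:F >].

Lemma locdenF_neq0 n (k : sgn n -> nat) : (locden k)%:F != 0 :> ratfun n.
Proof. by rewrite tofrac_eq0 locden_neq0. Qed.

Lemma ATloc_subring_closed n : subring_closed (@ATloc_pred n).
Proof.
split=> [|f g /asboolP[a [k ea]] /asboolP[b [l eb]]|
         f g /asboolP[a [k ea]] /asboolP[b [l eb]]]; apply/asboolP.
- exists 1, (fun=> 0%N) => w; rewrite !ffunE /locden big1 ?rmorph1 ?divr1 //.
- exists (a * gkm_const (@labelA n) (locden l) - b * gkm_const (@labelA n) (locden k)).
  exists (fun x => k x + l x)%N => w; rewrite !ffunE ea eb locdenD.
  rewrite -mulNr addf_div ?locdenF_neq0 // mulNr rmorphB.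
  by rewrite !(rmorphM (@FracField.tofrac _)).
- exists (a * b), (fun x => k x + l x)%N => w.
  by rewrite !ffunE ea eb locdenD !(rmorphM (@FracField.tofrac _)) mulf_div.
Qed.

HB.instance Definition _ n :=
  GRing.isSubringClosed.Build _ (@ATloc_pred n) (@ATloc_subring_closed n).

Record ATloc n := ATLoc {
  ATloc_val :> {ffun sperm n -> ratfun n};
  ATlocP : ATloc_val \in @ATloc_pred n
}.
HB.instance Definition _ n := [isSub for @ATloc_val n].
HB.instance Definition _ n := [Choice of ATloc n by <:].
HB.instance Definition _ n := GRing.SubChoice_isSubPzRing.Build
  _ (@ATloc_pred n) (ATloc n) (@ATloc_subring_closed n).

Lemma AT_to_ATloc_subproof n (a : AT n) :
  [ffun w => (a w)%:F] \in @ATloc_pred n.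
Proof.
apply/asboolP; exists a, (fun=> 0%N) => w; rewrite ffunE /locden big1 //.
by rewrite rmorph1 divr1.
Qed.

Definition AT_to_ATloc n (a : AT n) : ATloc n := ATLoc (AT_to_ATloc_subproof a).

Lemma ATloc_act_subproof n (w : sperm n) (g : ATloc n) :
  [ffun v => ract w (g (scomp (sinv w) v))] \in @ATloc_pred n.
Proof.
have /asboolP[a [k ea]] := ATlocP g; apply/asboolP.
exists (AT_act w a), (k \o sapp (sinv w)) => v.
by rewrite !ffunE ea ract_frac ?locden_neq0 // tact_locden.
Qed.

Definition ATloc_act n (w : sperm n) (g : ATloc n) : ATloc n :=
  ATLoc (ATloc_act_subproof w g).

Section Tensor.
Variables (M N : zmodType).

Notation F := {freeg (M * N) / int}.

Definition bilinear_relation (r : F) : Prop :=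
  (exists m m' x, r = << (m + m', x) >> - << (m, x) >> - << (m', x) >>) \/
  (exists m x x', r = << (m, x + x') >> - << (m, x) >> - << (m, x') >>).

(* The subgroup generated by the bilinear relations, as the intersection of all
   subgroups that contain them. *)
Definition tensor_pred : {pred F} := fun z =>
  `[< forall P : F -> Prop, P 0 -> (forall a b, P a -> P b -> P (a - b)) ->
        (forall r, bilinear_relation r -> P r) -> P z >].

Lemma tensor_zmod_closed : zmod_closed tensor_pred.
Proof.
split=> [|a b /asboolP ha /asboolP hb]; apply/asboolP => P P0 PB Pr //.
exact: (PB _ _ (ha P P0 PB Pr) (hb P P0 PB Pr)).
Qed.

HB.instance Definition _ := GRing.isZmodClosed.Build F tensor_pred tensor_zmod_closed.

Definition tensor : zmodType := Quotient.quot tensor_pred.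

Definition pure_tensor (m : M) (x : N) : tensor := \pi_tensor << (m, x) >>.

End Tensor.

Section TensorMap.
Variables (M M' N : zmodType) (f : {additive M -> M'}).

Definition freeg_map (z : {freeg (M * N) / int}) : {freeg (M' * N) / int} :=
  fglift (fun mx : M * N => << (f mx.1, mx.2) >>) z.

(* f (x) id_N as a map of abelian groups. For f a ring morphism and N a
   commutative ring, this map is a ring morphism for the ring structures of the
   tensor products, so that it is a ring isomorphism as soon as it is bijective. *)
Definition tensor_map (z : tensor M N) : tensor M' N :=
  \pi_(tensor M' N) (freeg_map (repr z)).

Lemma freeg_map_is_zmod_morphism : zmod_morphism freeg_map.
Proof. by move=> a b; apply: lift_is_additive. Qed.

HB.instance Definition _ := GRing.isZmodMorphism.Build _ _
  freeg_map freeg_map_is_zmod_morphism.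

Lemma freeg_mapU m x : freeg_map << (m, x) >> = << (f m, x) >>.
Proof. by rewrite /freeg_map liftU scale1r. Qed.

Lemma freeg_map_tensor_pred z :
  z \in @tensor_pred M N -> freeg_map z \in @tensor_pred M' N.
Proof.
move=> /asboolP/(_ (fun z => freeg_map z \in @tensor_pred M' N)); apply.
- by rewrite raddf0 rpred0.
- by move=> a b ha hb; rewrite raddfB rpredB.
move=> r hr; apply/asboolP => P _ _; apply; case: hr => -[m [m' [x ->]]].
  by left; exists (f m), (f m'), x; rewrite !raddfB /= !freeg_mapU raddfD.
by right; exists (f m), m', x; rewrite !raddfB /= !freeg_mapU.
Qed.

Lemma tensor_map_pi z :
  tensor_map (\pi_(tensor M N) z) = \pi_(tensor M' N) (freeg_map z).
Proof.
apply/eqP; rewrite -Quotient.idealrBE -raddfB freeg_map_tensor_pred //.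
by rewrite Quotient.idealrBE reprK.
Qed.

Lemma tensor_map_pure m x :
  tensor_map (pure_tensor m x) = pure_tensor (f m) x.
Proof. by rewrite /pure_tensor tensor_map_pi freeg_mapU. Qed.
End TensorMap.

(* Z[1/2] *)
Definition dyadic_pred : {pred rat} := fun x =>
  `[< exists (a : int) (k : nat), x = a%:~R / 2%:R ^+ k >].

Lemma dyadic_subring_closed : subring_closed dyadic_pred.
Proof.
have e2 k : 2%:R ^+ k != 0 :> rat by rewrite expf_neq0.
split=> [|x y /asboolP[a [k ->]] /asboolP[b [l ->]]|
         x y /asboolP[a [k ->]] /asboolP[b [l ->]]]; apply/asboolP.
- by exists 1, 0%N; rewrite expr0 divr1.
- exists (a * 2%:R ^+ l - b * 2%:R ^+ k), (k + l)%N.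
  by rewrite exprD -mulNr addf_div // mulNr rmorphB !rmorphM !rmorphXn.
- by exists (a * b), (k + l)%N; rewrite exprD mulf_div rmorphM.
Qed.

HB.instance Definition _ :=
  GRing.isSubringClosed.Build _ dyadic_pred dyadic_subring_closed.

Record dyadic := Dyadic {
  dyadic_val :> rat;
  dyadicP : dyadic_val \in dyadic_pred
}.
HB.instance Definition _ := [isSub for dyadic_val].
HB.instance Definition _ := [Choice of dyadic by <:].
HB.instance Definition _ := [SubChoice_isSubComNzRing of dyadic by <:].

Arguments tensor_map {M M'} N f z.

(* Main.v *)
Require Import Defs.
From HB Require Import structures.
From mathcomp Require Import all_boot all_order all_algebra all_fingroup.
From mathcomp Require Import generic_quotient ring_quotient fraction.
From mathcomp.multinomials Require Import freeg mpoly.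
From mathcomp Require Import boolp ring zify.

(** The substitution T_i = (1 + t_i) / (1 - t_i) turns each edge label 1 - T^c into
    the linear label times 2 and a unit of the localization, so it carries the
    congruences on the K-theory side to those on the Chow side; conversely, since
    1 + T_i = 2 / (1 - t_i), each tuple of polynomials becomes the image of a
    tuple of Laurent polynomials after multiplication by a power of
    theta = prod_i 2 / (1 - t_i), whose class in A(X) is a power of 2. Hence psi
    is surjective up to powers of 2, and its kernel is killed by a power of 2.
    It remains to see that K(X) has no 2-torsion. Order the fixed points by a
    generic linear functional on the type B permutohedron. The classes of the
    closed cells are triangular for this order, and by coprimality of the labels
    at a fixed point the lowest value of a tuple is divisible by the diagonal
    value of the corresponding cell class, so that a relation
    2 f = sum_i (T_i - 1) g_i can be cleared one fixed point at a time. *)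

Set Implicit Arguments.
Unset Strict Implicit.
Unset Printing Implicit Defensive.

Import Order.TTheory GRing.Theory Num.Theory.

Local Open Scope ring_scope.
Local Open Scope quotient_scope.

(** * Laurent polynomials *)

Lemma mpoly_ring_ind n (P : {mpoly int[n]} -> Prop) :
  (forall c : int, P c%:~R) -> (forall i, P 'X_i) ->
  (forall p q, P p -> P q -> P (p + q)) ->
  (forall p q, P p -> P q -> P (p * q)) -> forall p, P p.
Proof.
move=> Pc PX PD PM p; rewrite (mpolyE p).
apply: (big_ind P) => [|//|m _]; first exact: (Pc 0).
rewrite -mul_mpolyC; apply: (PM).
  by rewrite -[p@_m]intz (rmorph_int (@mpolyC n int)).
rewrite (mpolyXE_id _ m); apply: (big_ind P) => [|x y Px Py|i _].
- exact: (Pc 1).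
- exact: PM.
by elim: (m i) => [|k IH]; [exact: (Pc 1)|rewrite exprS; apply: (PM)].
Qed.

(** The telescoping p q - p' q' = (p - p') q + p' (q - q') settles products. It is applied with [v]
    a specialization that kills [p] or that leaves only its constant term. *)
Lemma mmap_sub_ideal n (A : comNzRingType) (u v : 'I_n -> A) p :
  exists a : 'I_n -> A,
    mmap intr u p - mmap intr v p = \sum_i a i * (u i - v i).
Proof.
elim/mpoly_ring_ind: p => [c|i|p q [a ea] [b eb]|p q [a ea] [b eb]].
- exists (fun=> 0); rewrite !rmorph_int subrr big1 // => i _; exact: mul0r.
- exists (fun j => (j == i)%:R); rewrite !mmapX !mmap1U.
  rewrite (bigD1 i) //= eqxx mul1r big1 ?addr0 // => j /negbTE->.
  exact: mul0r.
- exists (fun i => a i + b i); rewrite !rmorphD opprD addrACA ea eb -big_split.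
  by apply: eq_bigr => i _; rewrite mulrDl.
exists (fun i => a i * mmap intr u q + mmap intr v p * b i).
rewrite !rmorphM.
transitivity ((mmap intr u p - mmap intr v p) * mmap intr u q +
              mmap intr v p * (mmap intr u q - mmap intr v q)).
  by rewrite mulrBl mulrBr addrA subrK.
rewrite ea eb mulr_suml mulr_sumr -big_split; apply: eq_bigr => i _ /=.
by ring.
Qed.

(** * The substitution T_i = (1 + t_i) / (1 - t_i) *)

Section CayleySubstitution.
Variable n : nat.

Definition cayley (i : 'I_n) : ratfun n := (1 + ('X_i)%:F) / (1 - ('X_i)%:F).

Lemma tofrac_neq_meval (x y : {mpoly int[n]}) (z : 'I_n -> int) :
  x.@[z] != y.@[z] -> x%:F != y%:F :> ratfun n.
Proof. by move=> h; rewrite tofrac_eq; apply: contra_neq h => ->. Qed.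

Lemma one_addX_neq0 (i : 'I_n) : 1 + ('X_i)%:F != 0 :> ratfun n.
Proof.
rewrite -tofrac1 -tofracD -tofrac0; apply: (@tofrac_neq_meval _ _ (fun=> 0)).
by rewrite mevalD meval1 mevalXU meval0 addr0 oner_eq0.
Qed.

Lemma one_subX_neq0 (i : 'I_n) : 1 - ('X_i)%:F != 0 :> ratfun n.
Proof.
rewrite -tofrac1 -tofracB -tofrac0; apply: (@tofrac_neq_meval _ _ (fun=> 0)).
by rewrite mevalB meval1 mevalXU meval0 subr0 oner_eq0.
Qed.

Lemma ratfun2_neq0 : 2%:R != 0 :> ratfun n.
Proof.
have -> : 2%:R = (2%:R : {mpoly int[n]})%:F by rewrite rmorphMn rmorph1.
rewrite -tofrac0; apply: (@tofrac_neq_meval _ _ (fun=> 0)).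
by rewrite rmorphMn /= meval1 meval0.
Qed.

Lemma cayley_neq0 i : cayley i != 0.
Proof. by rewrite mulf_neq0 ?invr_eq0 ?one_addX_neq0 ?one_subX_neq0. Qed.

Definition Psi (f : laurent n) : ratfun n := leval cayley f.

Lemma Psi_is_zmod_morphism : zmod_morphism Psi.
Proof. exact: leval_is_zmod_morphism cayley_neq0. Qed.

Lemma Psi_is_monoid_morphism : monoid_morphism Psi.
Proof. exact: leval_is_monoid_morphism cayley_neq0. Qed.

HB.instance Definition _ :=
  GRing.isZmodMorphism.Build _ _ Psi Psi_is_zmod_morphism.
HB.instance Definition _ :=
  GRing.isMonoidMorphism.Build _ _ Psi Psi_is_monoid_morphism.

End CayleySubstitution.

Definition lvar n (x : sgn n) : laurent n := Laurent (Tsgn_laurent x).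

Lemma lvarK n (x : sgn n) : lvar x * lvar (bar x) = 1.
Proof.
by apply/val_inj; rewrite rmorphM rmorph1 /= Tsgn_bar divff // Tsgn_neq0.
Qed.

Lemma lvar_neq0 n (K : fieldType) (phi : {rmorphism laurent n -> K}) x :
  phi (lvar x) != 0.
Proof.
apply/eqP => h; have /eqP := rmorph1 phi.
by rewrite -(lvarK x) rmorphM /= h mul0r eq_sym oner_eq0.
Qed.

Lemma rmorph_lvar_bar n (K : fieldType) (phi : {rmorphism laurent n -> K}) x :
  phi (lvar (bar x)) = (phi (lvar x))^-1.
Proof.
apply: (mulfI (lvar_neq0 phi x)).
by rewrite -rmorphM lvarK rmorph1 divff // lvar_neq0.
Qed.

Lemma rmorph_mmap n (A B : comNzRingType) (phi : {rmorphism A -> B})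
  (u : 'I_n -> A) p : phi (mmap intr u p) = mmap intr (phi \o u) p.
Proof.
apply: (mpoly_rmorph_ext (f := phi \o mmap intr u)
  (g := mmap intr (phi \o u))) => i.
by rewrite /= !mmapX !mmap1U.
Qed.

Lemma val_mmap n (v : 'I_n -> laurent n) p :
  laurent_val (mmap intr v p) = mmap intr (fun i => laurent_val (v i)) p.
Proof.
exact: (rmorph_mmap (GRing.RMorphism.clone _ _ (val : laurent n -> ratfun n) _)).
Qed.

Lemma mmap_Tvar n p : laurent_val (mmap intr (@Tvar n) p) = p%:F.
Proof.
rewrite val_mmap.
apply: (mpoly_rmorph_ext (f := mmap intr _) (g := @FracField.tofrac _)) => i.
by rewrite /= mmapX mmap1U.
Qed.

(** A monomial denominator is a unit, with inverse the same monomial in the T_i^-1. The second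
    equation thus expresses [f] by ring operations alone, ready for any ring map. *)
Lemma laurent_numden n (f : laurent n) : exists p m,
  f * mmap intr (@Tvar n) 'X_[m] = mmap intr (@Tvar n) p /\
  f = mmap intr (@Tvar n) p * mmap1 (fun i => lvar (i, true)) m.
Proof.
have [p [m e]] := asboolP _ (laurentP f); exists p, m.
have e1 : f * mmap intr (@Tvar n) 'X_[m] = mmap intr (@Tvar n) p.
  by apply/val_inj; rewrite rmorphM /= !mmap_Tvar e divfK // mpolyXF_neq0.
split=> //; rewrite -e1 -mulrA mmapX /mmap1 -big_split big1 ?mulr1 // => i _ /=.
rewrite -exprMn -[Tvar i]/(lvar (i, false)) -[(i, true)]/(bar (i, false)).
by rewrite lvarK expr1n.
Qed.

Lemma laurent_rmorph_ext n (K : fieldType) (f g : {rmorphism laurent n -> K}) :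
  (forall i, f (Tvar i) = g (Tvar i)) -> f =1 g.
Proof.
move=> fg x; have [p [m [_ ->]]] := laurent_numden x.
rewrite !rmorphM /= !rmorph_mmap !(rmorph_prod f, rmorph_prod g) /=.
congr (_ * _).
  apply: (mpoly_rmorph_ext (f := mmap intr _) (g := mmap intr _)) => i.
  by rewrite /= !mmapX !mmap1U /= fg.
apply: eq_bigr => i _; rewrite !rmorphXn /=; congr (_ ^+ _).
by rewrite -[(i, true)]/(bar (i, false)) !rmorph_lvar_bar /= -fg.
Qed.

Lemma leval_mmap_Tvar n (K : fieldType) (u : 'I_n -> K) p :
  (forall i, u i != 0) -> leval u (mmap intr (@Tvar n) p) = mmap intr u p.
Proof.
move=> u0; rewrite (@leval_frac _ _ _ u0 _ p 0%MM) ?mmap11 ?divr1 //.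
by rewrite /= mmap_Tvar mpolyX0 rmorph1 divr1.
Qed.

Lemma leval_Tvar n (K : fieldType) (u : 'I_n -> K) i :
  (forall i, u i != 0) -> leval u (Tvar i) = u i.
Proof.
move=> u0; have -> : Tvar i = mmap intr (@Tvar n) 'X_i by rewrite mmapX mmap1U.
by rewrite leval_mmap_Tvar // mmapX mmap1U.
Qed.

Lemma laurent_mulf_eq0 n (f g : laurent n) : f * g = 0 -> f = 0 \/ g = 0.
Proof.
move/(congr1 val)/eqP; rewrite rmorphM rmorph0 mulf_eq0 => /orP[]/eqP h.
  by left; apply/val_inj; rewrite h rmorph0.
by right; apply/val_inj; rewrite h rmorph0.
Qed.

(** Up to a unit [f] is p(T), and p(v) = 0, so p(T) = p(T) - p(v) lies in the ideal of the T_i -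
    v_i. *)
Lemma leval_kernel n (v : 'I_n -> laurent n) f :
  (forall i, val (v i) != 0) -> leval (fun i => val (v i)) f = 0 ->
  exists a, f = \sum_i a i * (Tvar i - v i).
Proof.
move=> v0 h; have [p [m [e ->]]] := laurent_numden f.
have hp : mmap intr v p = 0.
  apply/val_inj; rewrite /= val_mmap -[LHS](@leval_mmap_Tvar n _ _ p v0) -e.
  by rewrite (leval_is_monoid_morphism v0).2 h mul0r.
have [a ea] := mmap_sub_ideal (@Tvar n) v p; rewrite hp subr0 in ea.
exists (fun i => a i * mmap1 (fun i => lvar (i, true)) m).
rewrite ea mulr_suml; apply: eq_bigr => i _; by rewrite mulrAC.
Qed.

(** The augmentation T_i = 1. It takes values in the field [ratfun n] because [leval] asks for a
    field; [leval_kernel] then applies with v_i = 1. *)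
Definition aug n (f : laurent n) : ratfun n := leval (fun=> 1) f.

Section Aug.
Variable n : nat.

Lemma aug_is_zmod_morphism : zmod_morphism (@aug n).
Proof. by apply: leval_is_zmod_morphism => i; apply: oner_neq0. Qed.

Lemma aug_is_monoid_morphism : monoid_morphism (@aug n).
Proof. by apply: leval_is_monoid_morphism => i; apply: oner_neq0. Qed.

HB.instance Definition _ :=
  GRing.isZmodMorphism.Build _ _ (@aug n) aug_is_zmod_morphism.
HB.instance Definition _ :=
  GRing.isMonoidMorphism.Build _ _ (@aug n) aug_is_monoid_morphism.

Lemma aug_Tvar (i : 'I_n) : aug (Tvar i) = 1.
Proof. by rewrite /aug leval_Tvar // => j; apply: oner_neq0. Qed.

Lemma aug_eq0 (f : laurent n) :
  aug f = 0 -> exists a, f = \sum_i a i * (Tvar i - 1).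
Proof.
move=> h; have v0 (_ : 'I_n) : val (1 : laurent n) != 0.
  by rewrite rmorph1 oner_neq0.
exact: (leval_kernel v0).
Qed.
End Aug.

Lemma mulr_crossD (R : comNzRingType) (p q a b : R) :
  p * a * b + q * b * a = (p + q) * (a * b).
Proof. ring. Qed.

Section FieldIdentities.
Variable K : fieldType.

Lemma add1_cayleyV (x : K) : x + 1 != 0 ->
  1 + (x - 1) / (x + 1) = x * (1 - (x - 1) / (x + 1)).
Proof. by move=> h; field. Qed.

Lemma sub1_cayleyV (x : K) : x + 1 != 0 -> 1 - (x - 1) / (x + 1) = 2%:R / (x + 1).
Proof. by move=> h; field. Qed.

Lemma add1_cayley (x : K) : 1 - x != 0 -> 1 + (1 + x) / (1 - x) = 2%:R / (1 - x).
Proof. by move=> h; field. Qed.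

Lemma cayley_sub1 (x : K) : 1 - x != 0 -> (1 + x) / (1 - x) - 1 = x * (2%:R / (1 - x)).
Proof. by move=> h; field. Qed.

End FieldIdentities.

Section PsiInjective.
Variable n : nat.

Let v (i : 'I_n) : ratfun n := (('X_i)%:F - 1) / (('X_i)%:F + 1).
Let A : {mpoly int[n]} := \prod_i (1 - 'X_i).

Let addX1_neq0 (i : 'I_n) : ('X_i)%:F + 1 != 0 :> ratfun n.
Proof. by rewrite addrC one_addX_neq0. Qed.

(* [q] is the numerator of p((1+t)/(1-t)); substituting t = (T-1)/(T+1) in it
   gives back a nonzero multiple of [p]. *)
Lemma cayley_numerator (p : {mpoly int[n]}) : exists q M,
  q%:F = mmap intr (@cayley n) p * A%:F ^+ M /\
  mmap intr v q = p%:F * mmap intr v A ^+ M.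
Proof.
elim/mpoly_ring_ind: p => [c|i|p q [a [M [ea ea']]] [b [N [eb eb']]]
                          |p q [a [M [ea ea']]] [b [N [eb eb']]]].
- by exists c%:~R, 0%N; rewrite !rmorph_int !mulr1.
- exists ((1 + 'X_i) * \prod_(j | j != i) (1 - 'X_j)), 1%N.
  have eA : A = (1 - 'X_i) * \prod_(j | j != i) (1 - 'X_j) by rewrite /A (bigD1 i).
  split.
    rewrite eA !rmorphM rmorphB rmorphD rmorph1 /= mmapX mmap1U /cayley mulrA.
    by rewrite divfK // one_subX_neq0.
  rewrite eA !rmorphM rmorphB rmorphD rmorph1 /= mmapX mmap1U mulrA.
  by rewrite /v add1_cayleyV ?addX1_neq0.
- exists (a * A ^+ N + b * A ^+ M), (M + N)%N; split.
    by rewrite !rmorphD !rmorphM !rmorphXn /= ea eb exprD mulr_crossD.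
  by rewrite !rmorphD !rmorphM !rmorphXn /= ea' eb' exprD mulr_crossD.
exists (a * b), (M + N)%N; split.
  by rewrite !rmorphM /= ea eb exprD mulrACA.
by rewrite !rmorphM /= ea' eb' exprD mulrACA.
Qed.

(** Substituting back t = (T - 1) / (T + 1) recovers the numerator of [f] up to a power of prod_i 2
    / (T_i + 1), which is nonzero. *)
Lemma Psi_inj : injective (@Psi n).
Proof.
apply: raddf_inj => f hf; have [p [m [e ef]]] := laurent_numden f.
have hp : mmap intr (@cayley n) p = 0.
  rewrite -(leval_mmap_Tvar p (@cayley_neq0 n)) -e -[leval _ _]/(Psi _).
  by rewrite rmorphM /= hf mul0r.
have [q [M []]] := cayley_numerator p; rewrite hp mul0r => /eqP.
rewrite tofrac_eq0 => /eqP->; rewrite raddf0 => /esym/eqP.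
rewrite mulf_eq0 expf_eq0 tofrac_eq0 => /orP[/eqP p0|/andP[_]].
  by rewrite ef p0 raddf0 mul0r.
rewrite rmorph_prod => /eqP/eqP/prodf_eq0[i _].
rewrite rmorphB rmorph1 /= mmapX mmap1U /v sub1_cayleyV ?addX1_neq0 //.
by rewrite mulf_eq0 invr_eq0 (negbTE (addX1_neq0 i)) (negbTE (ratfun2_neq0 n)).
Qed.

End PsiInjective.

(** * Lifting polynomials to Laurent polynomials *)

Section Lifting.
Variable n : nat.

Definition theta : ratfun n := \prod_i (2%:R / (1 - ('X_i)%:F)).

Definition laurent_theta : laurent n := \prod_i (1 + Tvar i).

Lemma Psi_Tvar (i : 'I_n) : Psi (Tvar i) = cayley i.
Proof. by rewrite /Psi leval_Tvar //; apply: cayley_neq0. Qed.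

Lemma Psi_addT1 (i : 'I_n) : Psi (1 + Tvar i) = 2%:R / (1 - ('X_i)%:F).
Proof.
by rewrite rmorphD rmorph1 /= Psi_Tvar add1_cayley ?one_subX_neq0.
Qed.

Lemma Psi_theta : Psi laurent_theta = theta.
Proof. by rewrite rmorph_prod; apply: eq_bigr => i _; apply: Psi_addT1. Qed.

Lemma aug_theta : aug laurent_theta = 2%:R ^+ n.
Proof.
rewrite rmorph_prod (eq_bigr (fun=> 2%:R)) ?prodr_const ?card_ord // => i _.
by rewrite rmorphD rmorph1 /= aug_Tvar.
Qed.

(** One factor of [theta] turns t_i into a Laurent polynomial, as t_i 2 / (1 - t_i) = T_i - 1. All
    large [N] are allowed so that finitely many polynomials can share one exponent; the augmentation
    is recorded because it determines the class of the constant [f] in K(X). *)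
Lemma Psi_lift (p : {mpoly int[n]}) : exists N0, forall N, (N0 <= N)%N ->
  exists f, Psi f = p%:F * theta ^+ N /\
            aug f = (p.@[fun=> 0])%:~R * 2%:R ^+ (n * N).
Proof.
suff [N0 [f [ef ef']]] : exists N0 f, Psi f = p%:F * theta ^+ N0 /\
            aug f = (p.@[fun=> 0])%:~R * 2%:R ^+ (n * N0).
  exists N0 => N /subnK <-; exists (f * laurent_theta ^+ (N - N0)).
  rewrite !rmorphM !rmorphXn /= ef ef' Psi_theta aug_theta mulnDr !exprD.
  by rewrite -!exprM -!mulrA; split; congr (_ * _); rewrite mulrC.
elim/mpoly_ring_ind: p => [c|i|p q [M [a [ea ea']]] [N [b [eb eb']]]
                          |p q [M [a [ea ea']]] [N [b [eb eb']]]].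
- by exists 0%N, c%:~R; rewrite !rmorph_int muln0 !mulr1.
- exists 1%N, ((Tvar i - 1) * \prod_(j | j != i) (1 + Tvar j)); split.
    rewrite expr1 [theta](bigD1 i) //= mulrA rmorphM rmorph_prod /=.
    congr (_ * _); last by apply: eq_bigr => j _; apply: Psi_addT1.
    by rewrite rmorphB rmorph1 /= Psi_Tvar cayley_sub1 ?one_subX_neq0.
  by rewrite rmorphM rmorphB rmorph1 /= aug_Tvar subrr mul0r mevalXU mul0r.
- exists (M + N)%N, (a * laurent_theta ^+ N + b * laurent_theta ^+ M).
  rewrite !rmorphD !rmorphM !rmorphXn /= ea ea' eb eb' Psi_theta aug_theta.
  rewrite mulnDr !exprD -!exprM. by split; rewrite mulr_crossD.
exists (M + N)%N, (a * b).
rewrite !rmorphM /= ea ea' eb eb' mulnDr !exprD.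
by split; rewrite mulrACA.
Qed.

End Lifting.

(** * The equivariant map and its descent to the quotients *)

Section LabelIdentities.
Variable K : fieldType.

Lemma cayley_label_diff (a b : K) : 1 - a != 0 -> 1 + b != 0 ->
  (a - b) *+ 2 =
  - ((1 - (1 + a) / (1 - a) * ((1 - b) / (1 + b))) * (1 - a) * (1 + b)).
Proof. by move=> ha hb; field; rewrite ha hb. Qed.

Lemma cayley_label_last (a : K) : 1 - a != 0 ->
  a *+ 2 = - ((1 - (1 + a) / (1 - a)) * (1 - a)).
Proof. by move=> ha; field. Qed.

(** Here [s] is the image of a label 1 - T^c, [l] is the linear label, and [x], [d] are units of the
    localization: s = -2 l / (x d), so a multiple of [s] is a multiple of [l]. *)
Lemma divr_label2 (l x d s g : K) : d != 0 -> x != 0 -> l *+ 2 = - (s * x * d) ->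
  s * g = l * (- 2%:R * (g * (x^-1 * d^-1))).
Proof.
move=> hd hx e; transitivity (- (l *+ 2) * (g * (x^-1 * d^-1))); last by ring.
by rewrite e; field; rewrite hd hx.
Qed.
End LabelIdentities.

Section Labels.
Variable n : nat.

Lemma sub_tsgn_neq0 (x : sgn n) : 1 - tsgn x != 0.
Proof.
have := locden_neq0 (fun y => (y == x) : nat).
by rewrite /locden (bigD1 x) //= eqxx expr1 mulf_eq0 negb_or => /andP[].
Qed.

Lemma sub_tsgnF_neq0 (x : sgn n) : 1 - (tsgn x)%:F != 0 :> ratfun n.
Proof. by rewrite -tofrac1 -tofracB tofrac_eq0 sub_tsgn_neq0. Qed.

Lemma add_tsgnF_neq0 (x : sgn n) : 1 + (tsgn x)%:F != 0 :> ratfun n.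
Proof. by have := sub_tsgnF_neq0 (bar x); rewrite tsgn_bar tofracN opprK. Qed.

Lemma Psi_lvar (x : sgn n) :
  Psi (lvar x) = (1 + (tsgn x)%:F) / (1 - (tsgn x)%:F).
Proof.
case: x => i [|]; last exact: Psi_Tvar.
rewrite -[(i, true)]/(bar (i, false)) rmorph_lvar_bar /= tsgn_bar tofracN opprK.
by rewrite (Psi_Tvar i : Psi (lvar (i, false)) = _) invf_div.
Qed.

Lemma labelKE (w : sperm n) i : labelK w i =
  if insub i.+1 is Some j
  then 1 - lvar (sapp w (i, false)) * lvar (bar (sapp w (j, false)))
  else 1 - lvar (sapp w (i, false)).
Proof.
apply/val_inj; rewrite /labelK; case: insubP => [j _ ej|h].
  rewrite !rmorphB !rmorphM !rmorph1 /=; congr (_ - _).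
  rewrite prod_edge_label; last exact: Tvar_neq0.
  by rewrite -ej valK Tsgn_bar.
rewrite !rmorphB !rmorph1 /=; congr (_ - _).
rewrite prod_edge_label; last exact: Tvar_neq0.
by rewrite insubF //; apply/negbTE.
Qed.

(** The factor at w(i) is kept apart from [d] because lifting back absorbs it into one [theta], by
    [Psi_half_theta], while [d] is lifted like any other polynomial. *)
Lemma Psi_labelK (w : sperm n) i : exists d : {mpoly int[n]},
  (d = 1 \/ exists y, d = 1 - tsgn y) /\
  (labelA w i)%:F *+ 2 =
  - (Psi (labelK w i) * (1 - (tsgn (sapp w (i, false)))%:F) * d%:F).
Proof.
rewrite labelKE labelAE; case: insub => [j|].
  exists (1 - tsgn (bar (sapp w (j, false)))); split; first by right; eexists.
  rewrite !rmorphB rmorphM !rmorph1 /= rmorph_lvar_bar /= !Psi_lvar invf_div.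
  rewrite tsgn_bar tofracN !opprK.
  set a := tsgn (sapp w (i, false)); set b := tsgn (sapp w (j, false)).
  move: (sub_tsgnF_neq0 (sapp w (i, false))) (add_tsgnF_neq0 (sapp w (j, false))).
  rewrite -/a -/b; move: (a%:F) (b%:F) => {}a {}b; exact: cayley_label_diff.
exists 1; split; first by left.
rewrite rmorphB rmorph1 /= Psi_lvar tofrac1 mulr1.
move: (sub_tsgnF_neq0 (sapp w (i, false))); exact: cayley_label_last.
Qed.

End Labels.

Section Localization.
Variable n : nat.
Implicit Types (g h : ratfun n) (k l : sgn n -> nat).

(** Membership in Z[t_1, ..., t_n] with all 1 - t_i and 1 + t_i inverted, for a single coordinate of
    a tuple. *)
Definition tlocal g := exists k q, g * (locden k)%:F = q%:F.

Lemma tlocal_poly p : tlocal p%:F.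
Proof.
exists (fun=> 0%N), p; rewrite /locden big1 ?rmorph1 ?mulr1 // => x _.
Qed.

Lemma tlocalD g h : tlocal g -> tlocal h -> tlocal (g + h).
Proof.
move=> [k [p ep]] [l [q eq]]; exists (fun x => k x + l x)%N.
exists (p * locden l + q * locden k).
by rewrite locdenD !(tofracD, tofracM) -ep -eq mulr_crossD.
Qed.

Lemma tlocalM g h : tlocal g -> tlocal h -> tlocal (g * h).
Proof.
move=> [k [p ep]] [l [q eq]]; exists (fun x => k x + l x)%N, (p * q).
by rewrite locdenD !tofracM -ep -eq mulrACA.
Qed.

Lemma tlocalV x : tlocal (1 - (tsgn x)%:F)^-1.
Proof.
exists (fun y => (y == x) : nat), 1.
rewrite /locden (bigD1 x) //= eqxx expr1 big1 ?mulr1 => [|y /negbTE->//].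
by rewrite tofracB tofrac1 mulVf // sub_tsgnF_neq0.
Qed.

Lemma tlocal_Psi f : tlocal (Psi f).
Proof.
have hx x : tlocal (Psi (lvar x)).
  rewrite Psi_lvar; apply: tlocalM (tlocalV x).
  by rewrite -tofrac1 -tofracD; apply: tlocal_poly.
have t1 : tlocal 1 by rewrite -tofrac1; apply: tlocal_poly.
have [p [m [_ ->]]] := laurent_numden f; rewrite rmorphM; apply: tlocalM.
  rewrite /= rmorph_mmap.
  elim/mpoly_ring_ind: p => [c|i|p q hp hq|p q hp hq].
  - by rewrite rmorph_int -(rmorph_int (@FracField.tofrac _)); apply: tlocal_poly.
  - by rewrite mmapX mmap1U; apply: (hx (i, false)).
  - by rewrite rmorphD; apply: tlocalD.
  by rewrite rmorphM; apply: tlocalM.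
rewrite rmorph_prod; apply: (big_ind tlocal) => // [g h|i _].
  exact: tlocalM.
rewrite rmorphXn; elim: (m i) => [|k IH]; first exact: t1.
by rewrite exprS; apply: tlocalM IH; apply: hx.
Qed.

Lemma tlocal_common (I : finType) (g : I -> ratfun n) :
  (forall i, tlocal (g i)) ->
  exists k, forall i, exists q, g i * (locden k)%:F = q%:F.
Proof.
move=> hg; have [k hk] := choice hg.
exists (fun x => \sum_i k i x)%N => i; have [q eq] := hk i.
exists (q * locden (fun x => \sum_(j | j != i) k j x)%N).
rewrite tofracM -eq -mulrA -tofracM -locdenD; congr (_ * (locden _)%:F).
by apply/funext => x; rewrite (bigD1 i).
Qed.

(* A common denominator is taken for all [f w] and for the quotients [g] of all
   the edge congruences, so that no divisibility by a label has to be cancelled. *)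
Lemma psiT_subproof (f : KT n) :
  [ffun w => Psi (f w)] \in @ATloc_pred n.
Proof.
have hf (wi : sperm n * 'I_n) := asboolP _ (gkmP f) wi.1 wi.2.
have [g hg] := choice hf.
have [d hd] := choice (fun wi : sperm n * 'I_n => Psi_labelK wi.1 wi.2).
pose quo wi := - 2%:R * (Psi (g wi) *
  ((1 - (tsgn (sapp wi.1 (wi.2, false)))%:F)^-1 * ((d wi)%:F)^-1)).
pose G (s : sperm n + sperm n * 'I_n) :=
  match s with inl w => Psi (f w) | inr wi => quo wi end.
have [|k hk] := @tlocal_common _ G.
  case=> [w|wi]; first exact: tlocal_Psi.
  have -> : G (inr wi) = quo wi by [].
  have t2 : tlocal (- 2%:R).
    have -> : - 2%:R = (- 2%:R)%:F :> ratfun n.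
      by rewrite tofracN rmorphMn rmorph1.
    exact: tlocal_poly.
  apply: tlocalM t2 _; apply: tlocalM (tlocal_Psi _) _.
  apply: tlocalM (tlocalV _) _; have [[->|[y ->]] _] := hd wi.
    by rewrite tofrac1 invr1 -tofrac1; apply: tlocal_poly.
  by rewrite tofracB tofrac1; apply: tlocalV.
have [q hq] := choice hk.
have gq : [ffun w => q (inl w)] \in gkm_pred (@labelA n).
  apply/asboolP => w i; exists (q (inr (w, i))); rewrite !ffunE.
  apply/eqP; rewrite -tofrac_eq tofracB tofracM -!hq /G mulrA -mulrBl.
  apply/eqP; congr (_ * _).
  have [hd1 hd2] := hd (w, i); rewrite -rmorphB (hg (w, i)) rmorphM /= /quo /=.
  have := hd2; rewrite /= => {hd2}.
  have d0 : (d (w, i))%:F != 0 :> ratfun n.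
    rewrite tofrac_eq0; case: hd1 => [->|[y ->]]; first exact: oner_neq0.
    exact: sub_tsgn_neq0.
  move: d0 (sub_tsgnF_neq0 (sapp w (i, false))) => d0 x0.
  exact: (fun e => divr_label2 (Psi (g (w, i))) d0 x0 e).
apply/asboolP; exists (GKM gq), k => w; rewrite !ffunE -hq.
by rewrite mulfK // locdenF_neq0.
Qed.

Definition psiT (f : KT n) : ATloc n := ATLoc (psiT_subproof f).
End Localization.

Lemma ffun_mulE (I : finType) (R : pzSemiRingType) (f g : {ffun I -> R}) i :
  (f * g) i = f i * g i.
Proof. by rewrite ffunE. Qed.

Lemma ffun_subE (I : finType) (R : zmodType) (f g : {ffun I -> R}) i :
  (f - g) i = f i - g i.
Proof. by rewrite !ffunE. Qed.

Section GkmConst.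
Variables (n : nat) (R : comNzRingType) (lab : sperm n -> 'I_n -> R).

Lemma gkm_const_is_zmod_morphism : zmod_morphism (gkm_const lab).
Proof. by move=> x y; apply/val_inj/ffunP => w; rewrite /= !ffunE. Qed.

Lemma gkm_const_is_monoid_morphism : monoid_morphism (gkm_const lab).
Proof. by split=> [|x y]; apply/val_inj/ffunP => w; rewrite /= !ffunE. Qed.

HB.instance Definition _ := GRing.isZmodMorphism.Build _ _
  (gkm_const lab) gkm_const_is_zmod_morphism.
HB.instance Definition _ := GRing.isMonoidMorphism.Build _ _
  (gkm_const lab) gkm_const_is_monoid_morphism.

Lemma gkmDE (f g : gkm lab) w : (f + g) w = f w + g w.
Proof. by rewrite /= ffunE. Qed.

Lemma gkmBE (f g : gkm lab) w : (f - g) w = f w - g w.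
Proof. by rewrite /= !ffunE. Qed.

Lemma gkmME (f g : gkm lab) w : (f * g) w = f w * g w.
Proof. by rewrite /= ffunE. Qed.

Lemma gkm_sumE (I : finType) (f : I -> gkm lab) w :
  (\sum_i f i) w = \sum_i f i w.
Proof.
apply: (big_morph (fun f : gkm lab => f w)) => [g h|]; first exact: gkmDE.
by rewrite /= ffunE.
Qed.

Lemma gkm_constE x w : gkm_const lab x w = x.
Proof. by rewrite ffunE. Qed.

Lemma gkm_crossE (a b : gkm lab) x y w :
  (a * gkm_const lab y - b * gkm_const lab x) w = a w * y - b w * x.
Proof. by rewrite gkmBE !gkmME !gkm_constE. Qed.

End GkmConst.

Section PsiTMorphism.
Variable n : nat.

Lemma psiTE (f : KT n) w : psiT f w = Psi (f w).
Proof. by rewrite ffunE. Qed.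

Lemma psiT_is_zmod_morphism : zmod_morphism (@psiT n).
Proof.
move=> f g; apply/val_inj/ffunP => w.
have e : psiT (f - g) w = Psi (f w - g w) by rewrite ffunE ffun_subE.
apply: etrans e _; rewrite rmorphB.
apply: etrans (esym (ffun_subE (psiT f) (psiT g) w)).
by congr (_ - _); apply/esym/psiTE.
Qed.

Lemma psiT_is_monoid_morphism : monoid_morphism (@psiT n).
Proof.
split=> [|f g]; apply/val_inj/ffunP => w; first by rewrite /= !ffunE rmorph1.
have e : psiT (f * g) w = Psi (f w * g w) by rewrite ffunE ffun_mulE.
apply: etrans e _; rewrite rmorphM.
apply: etrans (esym (ffun_mulE (psiT f) (psiT g) w)).
by congr (_ * _); apply/esym/psiTE.
Qed.

HB.instance Definition _ :=
  GRing.isZmodMorphism.Build _ _ (@psiT n) psiT_is_zmod_morphism.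
HB.instance Definition _ :=
  GRing.isMonoidMorphism.Build _ _ (@psiT n) psiT_is_monoid_morphism.

Lemma psiT_inj : injective (@psiT n).
Proof.
move=> f g e; apply/val_inj/ffunP => w; apply: Psi_inj.
apply: etrans (esym (psiTE f w)) (etrans _ (psiTE g w)).
by rewrite e.
Qed.

Lemma ATloc_fracP (g : ATloc n) : exists ak : AT n * (sgn n -> nat),
  forall w, g w = (ak.1 w)%:F / (locden ak.2)%:F.
Proof. by have /asboolP[a [k e]] := ATlocP g; exists (a, k). Qed.

(** The denominators have constant term 1 and hence become 1 in A(X), so the class of the numerator
    is the value; [pilocE] makes it independent of the chosen fraction. *)
Definition piloc (g : ATloc n) : AX n :=
  \pi_(AX n) (projT1 (cid (ATloc_fracP g))).1.

Lemma AT_const_pi (p : {mpoly int[n]}) :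
  \pi_(AX n) (gkm_const (@labelA n) p) = (p.@[fun=> 0])%:~R.
Proof.
rewrite -(rmorph_int (\pi_(AX n))) -(rmorph_int (gkm_const (@labelA n))).
apply/eqP; rewrite -Quotient.idealrBE; apply/asboolP.
have [b eb] := mmap_sub_ideal (fun i : 'I_n => 'X_i) (fun=> 0 : {mpoly int[n]}) p.
exists (fun i => gkm_const (@labelA n) (b i)).
have e1 : mmap intr (fun i : 'I_n => 'X_i) p = p.
  apply: (mpoly_rmorph_ext (f := mmap intr _) (g := idfun)) => i.
  by rewrite /= mmapX mmap1U.
have e2 : mmap intr (fun=> 0) p = (p.@[fun=> 0])%:~R :> {mpoly int[n]}.
  apply: (mpoly_rmorph_ext (f := mmap intr _) (g := intr \o meval (fun=> 0))) => i.
  by rewrite /= mmapX mmap1U mevalXU.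
rewrite -e2 -rmorphB -[X in X - _]e1 eb rmorph_sum.
by apply: eq_bigr => i _; rewrite subr0 rmorphM.
Qed.

Lemma locden_eval0 (k : sgn n -> nat) : (locden k).@[fun=> 0] = 1.
Proof.
rewrite /locden rmorph_prod big1 // => x _.
rewrite rmorphXn rmorphB rmorph1 /=.
suff -> : (tsgn x).@[fun=> 0] = 0 by rewrite subr0 expr1n.
by rewrite /tsgn; case: x.2; rewrite ?mevalN mevalXU ?oppr0.
Qed.

Lemma locden_pi k : \pi_(AX n) (gkm_const (@labelA n) (locden k)) = 1.
Proof. by rewrite AT_const_pi locden_eval0. Qed.

Lemma pilocE (g : ATloc n) (a : AT n) k :
  (forall w, g w = (a w)%:F / (locden k)%:F) -> piloc g = \pi_(AX n) a.
Proof.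
rewrite /piloc; case: cid => -[b l] /= eb ea.
suff e : b * gkm_const (@labelA n) (locden k) =
         a * gkm_const (@labelA n) (locden l).
  have := congr1 (\pi_(AX n)) e.
  by rewrite !rmorphM /= !locden_pi !mulr1.
apply/val_inj/ffunP => w; have ew := etrans (esym (eb w)) (ea w).
have e : b w * locden k = a w * locden l.
  apply/eqP; rewrite -tofrac_eq 2!tofracM -eqr_div ?locdenF_neq0 //.
  exact/eqP.
rewrite [LHS]gkmME [RHS]gkmME.
rewrite (gkm_constE _ (locden k) w) (gkm_constE _ (locden l) w).
exact: e.
Qed.

Lemma piloc_is_zmod_morphism : zmod_morphism piloc.
Proof.
move=> g h; have [[a k] /= ea] := ATloc_fracP g.
have [[b l] /= eb] := ATloc_fracP h.
rewrite (pilocE ea) (pilocE eb).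
rewrite (@pilocE _ (a * gkm_const (@labelA n) (locden l)
  - b * gkm_const (@labelA n) (locden k)) (fun x => k x + l x)%N) => [|w].
  by rewrite rmorphB !rmorphM /= !locden_pi !mulr1.
rewrite (gkm_crossE a b _ _ w) locdenD; apply: etrans (ffun_subE g h w) _.
rewrite (ea w) (eb w) -mulNr addf_div ?locdenF_neq0 // mulNr tofracB.
by rewrite 3!tofracM.
Qed.

Lemma piloc_is_monoid_morphism : monoid_morphism piloc.
Proof.
split=> [|g h].
  rewrite (@pilocE _ 1 (fun=> 0%N)) ?rmorph1 // => w.
  by rewrite /= !ffunE /locden big1 ?rmorph1 ?divr1.
have [[a k] /= ea] := ATloc_fracP g; have [[b l] /= eb] := ATloc_fracP h.
rewrite (pilocE ea) (pilocE eb) -rmorphM.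
apply: (@pilocE _ _ (fun x => k x + l x)%N) => w.
rewrite (gkmME a b w) locdenD; apply: etrans (ffun_mulE g h w) _.
by rewrite (ea w) (eb w) 2!tofracM mulf_div.
Qed.

HB.instance Definition _ :=
  GRing.isZmodMorphism.Build _ _ piloc piloc_is_zmod_morphism.
HB.instance Definition _ :=
  GRing.isMonoidMorphism.Build _ _ piloc piloc_is_monoid_morphism.

Lemma piloc_AT (a : AT n) : piloc (AT_to_ATloc a) = \pi_(AX n) a.
Proof.
apply: (@pilocE _ _ (fun=> 0%N)) => w.
by rewrite ffunE /locden big1 // rmorph1 divr1.
Qed.

Lemma piloc_psiT_ideal f : f \in @KT_ideal n -> piloc (psiT f) = 0.
Proof.
case/asboolP => a ->; rewrite rmorph_sum rmorph_sum big1 // => i _.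
rewrite !rmorphM /= [X in _ * X](_ : _ = 0) ?mulr0 //.
(* The image of T_i - 1 is 2 t_i / (1 - t_i), whose numerator lies in the ideal of the t_i. *)
rewrite (@pilocE _ (gkm_const (@labelA n) ('X_i *+ 2))
  (fun x => (x == (i, false)) : nat)) => [|w].
  by rewrite AT_const_pi mevalMn mevalXU mul0rn.
rewrite (gkm_constE _ _ w); apply: etrans (psiTE _ w) _.
rewrite (gkm_constE _ _ w) rmorphB rmorph1 /= Psi_Tvar.
have -> : locden (fun x => (x == (i, false)) : nat) = 1 - 'X_i.
  by rewrite /locden (bigD1 (i, false)) //= eqxx big1 ?mulr1 // => y /negbTE->.
rewrite cayley_sub1 ?one_subX_neq0 // tofracB tofrac1 rmorphMn /=.
by rewrite mulrA mulr_natr.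
Qed.

Definition psi (x : KX n) : AX n := piloc (psiT (repr x)).

Lemma psi_pi (f : KT n) : psi (\pi_(KX n) f) = piloc (psiT f).
Proof.
apply/eqP; rewrite -subr_eq0 /psi -rmorphB -rmorphB; apply/eqP.
by apply: piloc_psiT_ideal; rewrite Quotient.idealrBE reprK.
Qed.

Lemma psi_is_zmod_morphism : zmod_morphism psi.
Proof.
by move=> x y; rewrite -[x]reprK -[y]reprK -rmorphB !psi_pi !rmorphB.
Qed.

Lemma psi_is_monoid_morphism : monoid_morphism psi.
Proof.
split=> [|x y]; first by rewrite -(rmorph1 (\pi_(KX n))) psi_pi !rmorph1.
by rewrite -[x]reprK -[y]reprK -rmorphM !psi_pi !rmorphM.
Qed.

HB.instance Definition _ :=
  GRing.isZmodMorphism.Build _ _ psi psi_is_zmod_morphism.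
HB.instance Definition _ :=
  GRing.isMonoidMorphism.Build _ _ psi psi_is_monoid_morphism.

End PsiTMorphism.

(** The roles are: [t] is [theta], [u] a power of it, [c] a lift of s t / 2 and [h] a lift of - d g
    times [u]. The 2 gained from [c] cancels the 2 in 2 l = - L s d. *)
Lemma mulr_label2 (K : fieldType) (L l s d g c h t u : K) : 2%:R != 0 :> K ->
  l *+ 2 = - (L * s * d) -> c *+ 2 = s * t -> h = - (d * g) * u ->
  l * g * (t * u) = L * (c * h).
Proof.
move=> h2 el ec ->; apply: (mulfI h2).
transitivity ((l *+ 2) * (g * (t * u))); first by ring.
transitivity (- (L * (c *+ 2) * (d * g) * u)); last by ring.
by rewrite el ec; ring.
Qed.

Lemma half_theta_neg (K : fieldType) (x p : K) : 1 - x != 0 ->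
  (1 + x) / (1 - x) * p *+ 2 = (1 + x) * (2%:R / (1 - x) * p).
Proof. by move=> h; field. Qed.

Lemma half_theta_pos (K : fieldType) (x p : K) : 1 - x != 0 ->
  p *+ 2 = (1 - x) * (2%:R / (1 - x) * p).
Proof. by move=> h; field. Qed.

(** * Lifting tuples from the Chow side to the K-theory side *)

Section ATLift.
Variable n : nat.

(** The factor 2 / (1 - t_i) of [theta] times 1 - t_i is 2, and times 1 + t_i it is 2 T_i; both have
    an integral half. *)
Lemma Psi_half_theta (x : sgn n) :
  exists c, Psi c *+ 2 = (1 - (tsgn x)%:F) * theta n.
Proof.
case: x => i b.
pose c := \prod_(j | j != i) (1 + Tvar j) : laurent n.
have et : theta n = 2%:R / (1 - ('X_i)%:F) * Psi c.
  rewrite [theta n](bigD1 i) //= rmorph_prod; congr (_ * _).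
  by apply: eq_bigr => j _; rewrite -Psi_addT1.
case: b; rewrite /tsgn /= et.
  exists (Tvar i * c); rewrite rmorphM /= Psi_Tvar tofracN opprK.
  exact: half_theta_neg (one_subX_neq0 i).
by exists c; exact: half_theta_pos (one_subX_neq0 i).
Qed.

Lemma Psi_lift_family (I : finType) (p : I -> {mpoly int[n]}) :
  exists N0, forall N, (N0 <= N)%N ->
    exists f, forall i, Psi (f i) = (p i)%:F * theta n ^+ N.
Proof.
have [N0 h] := choice (fun i => Psi_lift (p i)).
exists (\sum_i N0 i)%N => N le_N.
have h' i : exists f, Psi f = (p i)%:F * theta n ^+ N.
  have [|f [ef _]] := h i N; last by exists f.
  by apply: leq_trans le_N; rewrite (bigD1 i) //= leq_addr.
by have [f hf] := choice h'; exists f.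
Qed.

Lemma AT_lift (a : AT n) : exists N0, forall N, (N0 <= N)%N ->
  exists F : KT n, forall w, Psi (F w) = (a w)%:F * theta n ^+ N.
Proof.
have ha (wi : sperm n * 'I_n) := asboolP _ (gkmP a) wi.1 wi.2.
have [g hg] := choice ha.
have [d hd] := choice (fun wi : sperm n * 'I_n => Psi_labelK wi.1 wi.2).
(* The quotients of the edge congruences are lifted together with the values, which provides the
   quotients for the lifted tuple. *)
pose p (s : sperm n + sperm n * 'I_n) :=
  match s with inl w => a w | inr wi => - (d wi * g wi) end.
(* The values get one more factor [theta] than the quotients; [Psi_half_theta] consumes it. *)
have [N0 hp] := Psi_lift_family p; exists N0.+1 => -[//|N] le_N.
have [f hf] := hp N.+1 (leqW le_N); have [f' hf'] := hp N le_N.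
have Fp : [ffun w => f (inl w)] \in gkm_pred (@labelK n).
  apply/asboolP => w i; have [c hc] := Psi_half_theta (sapp w (i, false)).
  exists (c * f' (inr (w, i))); rewrite !ffunE; apply: Psi_inj.
  rewrite rmorphB !rmorphM /= (hf (inl w)) (hf (inl _)) -mulrBl -tofracB.
  rewrite (hg (w, i)) /= tofracM exprS.
  apply: (mulr_label2 (ratfun2_neq0 n) (hd (w, i)).2 hc).
  by rewrite (hf' (inr (w, i))) /p tofracN tofracM.
by exists (GKM Fp) => w; rewrite (ffunE _ w) (hf (inl w)).
Qed.

End ATLift.

(** * Equivariance under signed permutations *)

Section Equivariance.
Variables (n : nat) (w : sperm n).

Lemma tact_neq0 p : p != 0 -> tact w p != 0.
Proof. by apply: contra_neq => e; apply: (@tact_inj _ w); rewrite e rmorph0. Qed.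

Lemma ratfun_fracP (g : ratfun n) :
  exists p q, q != 0 /\ g = p%:F / q%:F.
Proof.
exists \n_(repr g), \d_(repr g); split; first exact: denom_ratioP.
exact: frac_repr.
Qed.

Lemma ract_is_zmod_morphism : zmod_morphism (Defs.ract w).
Proof.
move=> g h; have [a [b [b0 ->]]] := ratfun_fracP g.
have [c [d [d0 ->]]] := ratfun_fracP h.
rewrite -mulNr addf_div ?tofrac_eq0 // mulNr -!tofracM -tofracB.
rewrite !ract_frac ?mulf_neq0 //.
rewrite -[in RHS]mulNr addf_div ?tofrac_eq0 ?tact_neq0 // mulNr.
by rewrite rmorphB !rmorphM tofracB !tofracM.
Qed.

Lemma ract_is_monoid_morphism : monoid_morphism (Defs.ract w).
Proof.
split=> [|g h].
  have := ract_frac w 1 (oner_neq0 {mpoly int[n]}).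
  by rewrite !rmorph1 invr1 mulr1.
have [a [b [b0 ->]]] := ratfun_fracP g.
have [c [d [d0 ->]]] := ratfun_fracP h.
rewrite mulf_div -!tofracM !ract_frac ?mulf_neq0 // !rmorphM.
by rewrite mulf_div.
Qed.

HB.instance Definition _ :=
  GRing.isZmodMorphism.Build _ _ (Defs.ract w) ract_is_zmod_morphism.
HB.instance Definition _ :=
  GRing.isMonoidMorphism.Build _ _ (Defs.ract w) ract_is_monoid_morphism.

(** Two ring maps into a field are compared on the T_i. The formula T_x = (1 + t_x) / (1 - t_x)
    holds for barred letters too, since t -> -t inverts the right-hand side. *)
Lemma Psi_lact f : Psi (lact w f) = Defs.ract w (Psi f).
Proof.
apply: (laurent_rmorph_ext (f := @Psi n \o lact w) (g := Defs.ract w \o @Psi n)) => i.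
rewrite /= Psi_Tvar.
have -> : lact w (Tvar i) = lvar (sapp w (i, false)).
  by apply/val_inj; rewrite /= leval_Tvar // => j; apply: Tsgn_neq0.
rewrite Psi_lvar /cayley -tofrac1 -!tofracD -!tofracB.
have := sub_tsgn_neq0 (i, false); rewrite {1}/tsgn /= => x0.
have tX : tact w 'X_i = tsgn (sapp w (i, false)) := tact_tsgn w (i, false).
by rewrite ract_frac // !(rmorphB, rmorphD) !rmorph1 /= tX.
Qed.

Lemma psiT_act (f : KT n) : psiT (KT_act w f) = ATloc_act w (psiT f).
Proof.
apply/val_inj/ffunP => v.
apply: etrans (psiTE _ v) _; rewrite (ffunE _ v) Psi_lact /=.
by rewrite (ffunE _ v) -(psiTE f).
Qed.

Lemma piloc_act (g : ATloc n) : piloc (ATloc_act w g) = AX_act w (piloc g).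
Proof.
have [[a k] /= ea] := ATloc_fracP g.
rewrite (pilocE ea) AX_act_pi.
apply: (@pilocE _ _ _ (k \o sapp (sinv w))) => v.
by rewrite (ffunE _ v) ea ract_frac ?locden_neq0 // tact_locden (ffunE _ v).
Qed.

Lemma psi_act (x : KX n) : psi (KX_act w x) = AX_act w (psi x).
Proof.
by rewrite -[x]reprK KX_act_pi !psi_pi psiT_act piloc_act.
Qed.

End Equivariance.

(** * The order of the fixed points by height *)

Section Height.
Variable n : nat.
Implicit Types (w v : sperm n) (x y : sgn n) (i j k : 'I_n).

(** The generic linear functional (1, 2, ..., n) on the vectors e_x. Starting at 1 keeps every
    weight nonzero and separates each letter from its bar. *)
Definition weight x : int := if x.2 then - (x.1.+1)%:Z else (x.1.+1)%:Z.

Lemma weight_bar x : weight (bar x) = - weight x.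
Proof. by case: x => i []; rewrite /weight /= ?opprK. Qed.

Lemma weight_inj : injective weight.
Proof.
move=> [i a] [j b]; rewrite /weight /= => h.
have [ij ab] : val i = val j /\ a = b by case: a b h => -[] /=; lia.
by congr pair => //; apply/val_inj.
Qed.

Lemma weight_neq0 x : weight x != 0.
Proof. by case: x => i []; rewrite /weight /=; lia. Qed.

Definition pos w i := sapp w (i, false).

Lemma sapp_inj w : injective (sapp w).
Proof. exact: can_inj (sKinv w). Qed.

Lemma pos_inj w : injective (pos w).
Proof. by move=> i j /sapp_inj[]. Qed.

Lemma pos_ext w v : (forall i, pos w i = pos v i) -> w = v.
Proof.
move=> h; apply: val_inj; apply/permP => -[i b].
rewrite -[LHS]/(sapp w (i, b)) -[RHS]/(sapp v (i, b)).
case: b; last exact: h.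
by rewrite -[(i, true)]/(bar (i, false)) !sapp_bar -!/(pos _ _) h.
Qed.

Lemma pos_tau w i k : pos (scomp w (tau i)) k =
  if insub i.+1 is Some j then pos w (tperm i j k)
  else if k == i then bar (pos w k) else pos w k.
Proof.
rewrite /pos scompE [sapp (tau i) _]tau_permE; case: insub => //=.
case: eqP => _ //=; exact: sapp_bar w (k, false).
Qed.

(** The value of this functional at the vertex sum_i (n - i) e_{w(i)} of the type B permutohedron,
    with [i] counted from 0. *)
Definition height w : int := \sum_(i < n) (n - i)%N%:Z * weight (pos w i).

Definition ascent w i : bool :=
  if insub i.+1 is Some j then weight (pos w i) < weight (pos w j)
  else weight (pos w i) < 0.

(** Consecutive coefficients differ by 1, so a swap changes the height by the difference of two
    weights; a sign change at the last position changes it by -2 times a weight. Equality is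
    excluded because weights are distinct and nonzero. *)
Lemma height_le_ascent w i :
  height w <= height (scomp w (tau i)) -> ascent w i.
Proof.
rewrite /height /ascent; under [X in _ <= X]eq_bigr do rewrite pos_tau.
case: insubP => [j _ ij|].
  have ne : j != i by rewrite -val_eqE; move: ij => /= ->; lia.
  rewrite [X in _ <= X](reindex_inj (@perm_inj _ (tperm i j))) /=.
  under [X in _ <= X]eq_bigr do rewrite tpermK.
  rewrite (bigD1 i) //= (bigD1 j) //= [X in _ <= X](bigD1 i) //=.
  rewrite [X in _ <= _ + X](bigD1 j) //= tpermL tpermR.
  rewrite [X in _ <= _ + (_ + X)]
    (eq_bigr (fun k : 'I_n => (n - k)%N%:Z * weight (pos w k))).
    rewrite !addrA lerD2r => h.
    have : weight (pos w i) != weight (pos w j).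
      by apply: contra_neq ne => /weight_inj/pos_inj ->.
    have ltj := ltn_ord j; move: ij h ltj => /= ->.
    by move: (weight _) (weight _) => a b; move: (nat_of_ord i) => m; nia.
  by move=> k /andP[k1 k2]; rewrite tpermD // eq_sym.
move=> hi; rewrite (bigD1 i) //= [X in _ <= X](bigD1 i) //= eqxx.
rewrite [X in _ <= _ + X]
  (eq_bigr (fun k : 'I_n => (n - k)%N%:Z * weight (pos w k))).
  rewrite lerD2r weight_bar.
  have := weight_neq0 (pos w i); have := ltn_ord i; move: hi.
  by move: (weight _) => a; move: (nat_of_ord i) => m; nia.
by move=> k /negbTE ->.
Qed.

(** The letters whose vectors add up to the [i]-th ray of the cone of [w]. *)
Definition flag w i : {set sgn n} := [set pos w j | j : 'I_n & (j <= i)%N].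

Lemma flagP w i x :
  reflect (exists2 j : 'I_n, (j <= i)%N & x = pos w j) (x \in flag w i).
Proof.
apply: (iffP imsetP) => -[j]; rewrite ?inE => h ->; first by exists j.
by exists j; rewrite ?inE.
Qed.

(** Adjacent maximal cones share all rays but one. Both flags have the same cardinality, so one
    inclusion suffices. *)
Lemma flag_tau w i j : i != j -> flag (scomp w (tau i)) j = flag w j.
Proof.
move=> ij; apply/eqP; rewrite eqEcard; apply/andP; split; last first.
  by rewrite !card_imset //; apply: pos_inj.
apply/subsetP => x /flagP[k kj ->]; apply/flagP; rewrite pos_tau.
have nij : (i != j :> nat) by rewrite val_eqE.
case: insubP => [i' _ ei'|hi].
  case: tpermP => [ki|ki|_ _]; last by exists k.
    by exists i' => //; move: ei' => /=; subst k; lia.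
  by exists i => //; move: ei' => /=; subst k; lia.
case: eqP => [ki|_]; last by exists k.
by subst k; have := ltn_ord j; lia.
Qed.

Lemma ascent_homo w i j : (i <= j)%N ->
  (forall k, (i <= k)%N -> (k < j)%N -> ascent w k) ->
  weight (pos w i) <= weight (pos w j).
Proof.
move=> ij h; have [d ed] : exists d, (j = i + d :> nat)%N by exists (j - i)%N; lia.
elim: d j ij h ed => [|d IH] j ij h ed.
  by have -> : j = i by apply/val_inj; rewrite /= ed addn0.
have ltd : (i + d < n)%N by have := ltn_ord j; lia.
pose k := Ordinal ltd; apply: (@le_trans _ _ (weight (pos w k))).
  by apply: IH => //= [|l h1 h2]; [lia|apply: h; lia].
have := h k; rewrite /ascent /= => h'; apply: ltW; move: h'.
have -> : insub (i + d).+1 = Some j by rewrite -addnS -ed; apply: valK.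
by apply; lia.
Qed.

Lemma ascent_neg w i : (forall k, (i <= k)%N -> ascent w k) ->
  weight (pos w i) < 0.
Proof.
move=> h; have ltl : (n.-1 < n)%N by have := ltn_ord i; lia.
pose l := Ordinal ltl; have il : (i <= l)%N by have := ltn_ord i; rewrite /=; lia.
apply: (@le_lt_trans _ _ (weight (pos w l))).
  by apply: ascent_homo => // k ik _; apply: h.
have := h l il; rewrite /ascent insubF //=.
by have := ltn_ord i; lia.
Qed.

(* [v] and [w] list the same letters on each block of consecutive ascents, in
   the same order; the letters of a last block of ascents may differ by signs
   but are all negative. *)
Lemma sorted_le v w i :
  (forall j, ascent v j && ascent w j || (flag w j == flag v j)) ->
  (forall k, (k < i)%N -> pos w k = pos v k) ->
  weight (pos w i) <= weight (pos v i).
Proof.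
move=> hvw agree.
(* If some flag at or after [i] is shared, the first one ends the block of [i]: then v(i) is w(k)
   for some [k] in this block, and [w] ascends from [i] to [k]. Otherwise [i] lies in the last
   block. *)
have [[j0 hj0]|none] := EM (exists j, (i <= j)%N && (flag w j == flag v j)).
  pose P j := (i <= j)%N && (flag w j == flag v j).
  have [j /andP[ij /eqP ej] jmin] := @arg_minnP _ j0 P (@nat_of_ord n) hj0.
  have : pos v i \in flag w j by rewrite ej; apply/flagP; exists i.
  case/flagP => k kj ek; have ik : (i <= k)%N.
    rewrite leqNgt; apply/negP => ki.
    by move: ek; rewrite agree // => /pos_inj ik; rewrite ik ltnn in ki.
  rewrite ek; apply: ascent_homo => // l il lk.
  have /orP[/andP[]//|el] := hvw l.
  have := jmin l; rewrite /P il el => /(_ isT); lia.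
have asc k : (i <= k)%N -> ascent v k && ascent w k.
  move=> ik; have /orP[//|e] := hvw k.
  by case: none; exists k; rewrite ik.
have negw k : (i <= k)%N -> weight (pos w k) < 0.
  move=> ik; apply: ascent_neg => l kl.
  by have /andP[] := asc l (leq_trans ik kl).
have negv : weight (pos v i) < 0.
  by apply: ascent_neg => l il; have /andP[] := asc l il.
(* In the last block v(i) is w(k) or its bar; the bar has positive weight, whereas v(i) has negative
   weight. *)
case e: (sapp (sinv w) (pos v i)) => [k b].
have ek : pos v i = sapp w (k, b) by rewrite -e sinvK.
have ik : (i <= k)%N.
  rewrite leqNgt; apply/negP => ki; have := agree k ki; move: ek.
  case: b {e} => ek ewv; last first.
    move: ek; rewrite -[RHS]/(pos w k) ewv => /pos_inj ik.
    by rewrite ik ltnn in ki.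
  move: ek; rewrite -[(k, true)]/(bar (k, false)) sapp_bar -/(pos w k) ewv.
  by rewrite /pos -sapp_bar => /sapp_inj.
case: b e ek => _ ek.
  move: negv; rewrite ek -[(k, true)]/(bar (k, false)) sapp_bar weight_bar.
  by rewrite oppr_lt0 ltNge ltW // -/(pos w k) negw.
rewrite ek; apply: ascent_homo => // l il _.
by have /andP[] := asc l il.
Qed.

Lemma sorted_unique v w :
  (forall j, ascent v j && ascent w j || (flag w j == flag v j)) -> w = v.
Proof.
move=> hvw; apply: pos_ext => i.
have [m] := ubnP (i : nat); elim: m i => // m IH i im.
have agree k : (k < i)%N -> pos w k = pos v k by move=> ki; apply: IH; lia.
apply: weight_inj; apply/eqP; rewrite eq_le; apply/andP; split.
  exact: sorted_le hvw agree.
apply: sorted_le => [j|k ki]; last by rewrite agree.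
by rewrite andbC eq_sym.
Qed.

(** The [w] sharing with [v] the flags at the descents of [v] are the fixed points of an orbit
    closure. At a height minimum of this set every other direction is an ascent, since crossing it
    preserves these flags; the same holds at [v], so [sorted_unique] identifies every minimum with
    [v]. *)
Lemma height_min v w :
  (forall j, height (scomp v (tau j)) < height v -> flag w j = flag v j) ->
  w = v \/ height v < height w.
Proof.
pose C u := [forall j : 'I_n,
  (height (scomp v (tau j)) < height v) ==> (flag u j == flag v j)].
have CP u : reflect (forall j, height (scomp v (tau j)) < height v ->
    flag u j = flag v j) (C u).
  apply: (iffP forallP) => h j; first by move=> hj; apply/eqP/(implyP (h j)).
  by apply/implyP => hj; apply/eqP/h.
have min_eq u : C u -> (forall u', C u' -> height u <= height u') -> u = v.
  move=> /CP Cu umin; apply: sorted_unique => j.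
  case: (ltP (height (scomp v (tau j))) (height v)) => hj.
    by rewrite Cu // eqxx orbT.
  rewrite !height_le_ascent //; apply: umin; apply/CP => k hk.
  rewrite flag_tau ?Cu //; apply/eqP => jk; subst k.
  by move: hk; rewrite ltNge hj.
move=> /CP Cw; case: (Order.TotalTheory.arg_minP height Cw) => u Cu umin.
have uv := min_eq u Cu umin; subst u.
have := umin w Cw; rewrite le_eqVlt => /orP[/eqP e|]; last by right.
by left; apply: min_eq => // u' Cu'; rewrite -e umin.
Qed.

End Height.

(** * Coprimality of the edge labels *)

Lemma factor_label_bar (R : comNzRingType) (a t t' q : R) :
  t * t' = 1 -> a * (t - q) = (1 - t' * q) * (a * t).
Proof. by move=> h; transitivity (a * t - a * q * (t * t')); [rewrite h; ring|ring]. Qed.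

Lemma factor_label (R : comNzRingType) (a t p q : R) :
  p * q = 1 -> a * (t - p) = (1 - t * q) * (- a * p).
Proof. by move=> h; transitivity (a * t * (p * q) - a * p); [rewrite h; ring|ring]. Qed.

Section Divisors.
Variable n : nat.
Implicit Types (w v : sperm n) (x y : sgn n) (i j k : 'I_n).

Lemma Tsgn_inj : injective (@Tsgn n).
Proof.
have XX i j : ('X_i)%:F != (('X_j)%:F)^-1 :> ratfun n.
  apply/eqP => /(congr1 ( *%R^~ ('X_j)%:F)); rewrite mulVf ?Tvar_neq0 //.
  rewrite -tofracM -tofrac1 => /eqP; rewrite tofrac_eq => /eqP.
  move/(congr1 (meval (fun=> 0))); rewrite mevalM mevalXU mul0r meval1.
  by move/eqP; rewrite eq_sym oner_eq0.
have XI i j : ('X_i)%:F = ('X_j)%:F :> ratfun n -> i = j.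
  move/eqP; rewrite tofrac_eq => /eqP /(congr1 (mcoeff U_(i))).
  rewrite !mcoeffX eqxx; case: eqP => // /(congr1 (fun m : 'X_{1..n} => m i)).
  by rewrite !mnm1E eqxx; case: eqP.
move=> [i a] [j b]; rewrite /Tsgn /=.
case: a b => -[] h.
- by rewrite (XI _ _ (invr_inj h)).
- by have := XX j i; rewrite -h eqxx.
- by have := XX i j; rewrite h eqxx.
- by rewrite (XI _ _ h).
Qed.

Lemma Tsgn_neq1 x : Tsgn x != 1.
Proof.
apply/eqP => h; have := @Tsgn_inj x (bar x); rewrite Tsgn_bar h invr1.
by case: x {h} => i b /(_ erefl)[] /=; case: b.
Qed.

Lemma pos_fst_inj w i j : (pos w i).1 = (pos w j).1 -> i = j.
Proof.
case ei: (pos w i) => [k a]; case ej: (pos w j) => [l b] /= kl; subst l.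
have [ab|ab] := eqVneq a b.
  by apply: (@pos_inj _ w); rewrite ei ej ab.
have : pos w i = bar (pos w j).
  by rewrite ei ej /bar /=; congr pair; case: (a) (b) ab => -[].
by rewrite /pos -sapp_bar => /sapp_inj[].
Qed.

Lemma leval_lvar (K : fieldType) (u : 'I_n -> K) x : (forall i, u i != 0) ->
  leval u (lvar x) = if x.2 then (u x.1)^-1 else u x.1.
Proof.
move=> u0; case: x => i [] /=; last exact: leval_Tvar.
apply: (mulfI (u0 i)); rewrite divff // -{1}(leval_Tvar i u0).
have [h1 hM] := leval_is_monoid_morphism u0.
by rewrite -hM -[(i, true)]/(bar (i, false)) lvarK h1.
Qed.

(** The value that the vanishing of the [i]-th label forces on T_{w(i)}. The default 1 at the last
    position lets both kinds of label read 1 - T_{w(i)} / [lnext w i]. *)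
Definition lnext w i : laurent n :=
  if insub i.+1 is Some j then lvar (pos w j) else 1.
Definition lnextV w i : laurent n :=
  if insub i.+1 is Some j then lvar (bar (pos w j)) else 1.

Lemma lnextK w i : lnext w i * lnextV w i = 1.
Proof. by rewrite /lnext /lnextV; case: insub => [j|]; rewrite ?lvarK ?mulr1. Qed.

Lemma labelK_next w i : labelK w i = 1 - lvar (pos w i) * lnextV w i.
Proof. by rewrite labelKE /lnextV; case: insub => [j|]; rewrite ?mulr1. Qed.

(* The specialization of the [T_k] with kernel generated by [labelK w j]. *)
Definition wall w j k : laurent n :=
  if k == (pos w j).1 then if (pos w j).2 then lnextV w j else lnext w j
  else Tvar k.

Lemma val_lnext_neq0 w i : val (lnext w i) != 0.
Proof.
by rewrite /lnext; case: insub => [j|]; rewrite /= ?Tsgn_neq0 ?oner_neq0.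
Qed.

Lemma val_lnextV w i : val (lnextV w i) = (val (lnext w i))^-1.
Proof.
rewrite /lnext /lnextV; case: insub => [j|] /=; first exact: Tsgn_bar.
by rewrite invr1.
Qed.

Lemma wall_neq0 w j k : val (wall w j k) != 0.
Proof.
rewrite /wall; case: (k =P _) => _; last exact: (Tsgn_neq0 (k, false)).
by case: ifP => _; rewrite ?val_lnextV ?invr_eq0 val_lnext_neq0.
Qed.

Definition on_wall w j (f : laurent n) : ratfun n :=
  leval (fun k => val (wall w j k)) f.

Lemma on_wallM w j : {morph on_wall w j : f g / f * g}.
Proof. exact: (leval_is_monoid_morphism (wall_neq0 w j)).2. Qed.

Lemma on_wall1 w j : on_wall w j 1 = 1.
Proof. exact: (leval_is_monoid_morphism (wall_neq0 w j)).1. Qed.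

Lemma on_wallB w j : {morph on_wall w j : f g / f - g}.
Proof. exact: (leval_is_zmod_morphism (wall_neq0 w j)). Qed.

Lemma on_wall_pos w j i :
  on_wall w j (lvar (pos w i)) =
  if i == j then val (lnext w j) else Tsgn (pos w i).
Proof.
rewrite /on_wall leval_lvar; last exact: wall_neq0.
rewrite /wall; case: (eqVneq i j) => [->|ij].
  rewrite eqxx; case: (pos w j).2 => //; rewrite val_lnextV.
  exact: invrK.
have -> : ((pos w i).1 == (pos w j).1) = false.
  by apply/negbTE; apply: contra_neq ij; apply: pos_fst_inj.
by rewrite /Tsgn.
Qed.

Lemma on_wall_bar w j i :
  on_wall w j (lvar (bar (pos w i))) = (on_wall w j (lvar (pos w i)))^-1.
Proof.
have h := on_wallM w j (lvar (pos w i)) (lvar (bar (pos w i))).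
rewrite lvarK on_wall1 in h.
have h0 : on_wall w j (lvar (pos w i)) != 0.
  by apply/eqP => e; move/eqP: h; rewrite e mul0r oner_eq0.
by apply: (mulfI h0); rewrite -h divff.
Qed.

Lemma on_wall_label w j : on_wall w j (labelK w j) = 0.
Proof.
rewrite labelK_next on_wallB on_wall1 on_wallM on_wall_pos eqxx.
suff -> : on_wall w j (lnextV w j) = (val (lnext w j))^-1.
  by rewrite divff ?subrr // val_lnext_neq0.
rewrite /lnextV /lnext; case: insubP => [k _ jk|_]; last first.
  by rewrite on_wall1 /= invr1.
rewrite on_wall_bar on_wall_pos ifN //.
by rewrite -val_eqE jk gtn_eqF.
Qed.

(** On the wall [j] only T_{w(j)} changes, to T_{w(j+1)} or 1. The label at [i] still compares two
    distinct letters, or a letter with 1, also when i + 1 = j. *)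
Lemma on_wall_neq0 w i j : i != j -> on_wall w j (labelK w i) != 0.
Proof.
move=> ij; rewrite labelK_next on_wallB on_wall1 on_wallM on_wall_pos.
rewrite (negbTE ij) subr_eq0 eq_sym /lnextV.
case: insubP => [k _ ik|_]; last by rewrite on_wall1 mulr1 Tsgn_neq1.
rewrite on_wall_bar on_wall_pos; case: (k =P j) => [kj|_]; last first.
  apply/eqP => h; have : Tsgn (pos w i) = Tsgn (pos w k).
    by apply: (divIf (Tsgn_neq0 (pos w k))); rewrite h divff // Tsgn_neq0.
  by move=> /Tsgn_inj/pos_inj e; move: ik; rewrite e => /eqP; rewrite ltn_eqF.
subst k; apply/eqP => h; have : Tsgn (pos w i) = val (lnext w j).
  by apply: (divIf (val_lnext_neq0 w j)); rewrite h divff // val_lnext_neq0.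
rewrite /lnext; case: insubP => [l _ jl|_] /=; last first.
  by move/eqP; rewrite (negbTE (Tsgn_neq1 _)).
by move=> /Tsgn_inj/pos_inj e; move: jl; rewrite -e ik /= => /eqP; rewrite ltn_eqF.
Qed.

(** Of the generators of the kernel given by [leval_kernel] only the one for the letter of w(j) is
    nonzero, and it is a multiple of the label. *)
Lemma on_wall_eq0 w j f : on_wall w j f = 0 -> exists g, f = labelK w j * g.
Proof.
move=> /(leval_kernel (wall_neq0 w j))[a ->].
rewrite (bigD1 (pos w j).1) //= big1 ?addr0 => [|k /negbTE kj]; last first.
  by rewrite /wall kj subrr mulr0.
rewrite /wall eqxx labelK_next; case e: (pos w j) => [k b] /=.
case: b {e}.
  exists (a k * Tvar k); apply: factor_label_bar; exact: lvarK (k, false).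
exists (- a k * lnext w j); apply: factor_label; exact: lnextK.
Qed.

Lemma labelK_neq0 w i : labelK w i != 0.
Proof.
apply/eqP => /(congr1 val); rewrite labelK_next rmorphB rmorphM rmorph1 /= val_lnextV.
move/eqP; rewrite subr_eq0 eq_sym => /eqP h.
have : Tsgn (pos w i) = val (lnext w i).
  by apply: (divIf (val_lnext_neq0 w i)); rewrite h divff // val_lnext_neq0.
rewrite /lnext; case: insubP => [l _ jl|_] /=; last first.
  by move/eqP; rewrite (negbTE (Tsgn_neq1 _)).
by move=> /Tsgn_inj/pos_inj e; move: jl; rewrite -e => /eqP; rewrite ltn_eqF.
Qed.

(** Each label generates the kernel of a ring map to a field, and this map kills no other label at
    [w]. Restricting to the wall [j] therefore shows that the cofactor of the labels already divided
    out is divisible by the [j]-th label. *)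
Lemma labelK_prod_dvd w (P : pred 'I_n) f :
  (forall j, P j -> exists g, f = labelK w j * g) ->
  exists g, f = \prod_(j | P j) labelK w j * g.
Proof.
move=> hf; rewrite -big_filter.
have : forall j, j \in [seq j <- index_enum 'I_n | P j] -> P j.
  by move=> j; rewrite mem_filter => /andP[].
have := filter_uniq P (index_enum_uniq 'I_n).
elim: [seq _ <- _ | _] => [_ _|j s IH /andP[js us] sP].
  by exists f; rewrite big_nil mul1r.
have [|g eg] := IH us; first by move=> k ks; apply: sP; rewrite inE ks orbT.
have [h eh] := hf j (sP j (mem_head _ _)).
have /on_wall_eq0[g' eg'] : on_wall w j g = 0.
  have : on_wall w j f = 0 by rewrite eh on_wallM on_wall_label mul0r.
  rewrite eg on_wallM (big_morph _ (on_wallM w j) (on_wall1 w j)) => /eqP.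
  rewrite mulf_eq0 => /orP[|/eqP//]; rewrite prodf_seq_eq0 => /hasP[k ks] /=.
  rewrite (negbTE (on_wall_neq0 _ _)) //.
  by apply: contraNneq js => <-.
by exists g'; rewrite big_cons eg eg' mulrA (mulrC (labelK w j)).
Qed.

End Divisors.

(** * The cell classes and the absence of 2-torsion *)

Lemma congr_mul (R : comNzRingType) (l a b a' b' : R) :
  (exists g, a - a' = l * g) -> (exists h, b - b' = l * h) ->
  exists g, a * b - a' * b' = l * g.
Proof.
move=> [g eg] [h eh]; exists (g * b + a' * h).
by rewrite mulrDr mulrA -eg mulrCA -eh mulrBl mulrBr addrA subrK.
Qed.

Lemma sub_sub1 (R : comNzRingType) (a b : R) : (1 - a) - (1 - b) = - (a - b).
Proof. ring. Qed.

Lemma sub_inv_factor (R : comNzRingType) (p q : R) : p * q = 1 ->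
  p - q = (1 - p) * - ((1 + p) * q).
Proof. by move=> h; transitivity (p * (p * q) - q); [rewrite h mulr1|ring]. Qed.

Section Classes.
Variable n : nat.
Implicit Types (w v : sperm n) (x y : sgn n) (i j k : 'I_n) (f : KT n).

(** The tuple of the T_{w(x)} satisfies all edge congruences: [tau i] either fixes the letter or
    replaces it by one whose variable agrees with it modulo the label. The labels, built from such
    tuples, inherit this. *)
Lemma lvar_congr w i x : exists g,
  lvar (sapp w x) - lvar (sapp (scomp w (tau i)) x) = labelK w i * g.
Proof.
have flip (l : laurent n) y z g : lvar y - lvar z = l * g ->
    exists h, lvar z - lvar y = l * h.
  by move=> e; exists (- g); rewrite mulrN -e opprB.
case: x => k b; rewrite scompE [sapp (tau i) _]tau_permE labelKE /=.
case: insubP => [j _ ij|_].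
  have pq : lvar (sapp w (i, false)) - lvar (sapp w (j, false)) =
    (1 - lvar (sapp w (i, false)) * lvar (bar (sapp w (j, false)))) *
      - lvar (sapp w (j, false)).
    by rewrite mulrN mulrBl mul1r -mulrA (mulrC (lvar (bar _))) lvarK mulr1 opprB.
  have pq' : lvar (sapp w (i, true)) - lvar (sapp w (j, true)) =
    (1 - lvar (sapp w (i, false)) * lvar (bar (sapp w (j, false)))) *
      lvar (sapp w (i, true)).
    rewrite -![(_, true)]/(bar (_, false)) !sapp_bar mulrBl mul1r mulrAC lvarK.
    by rewrite mul1r.
  case: tpermP => [->|->|_ _]; last by exists 0; rewrite subrr mulr0.
    by case: b; eexists; [exact: pq'|exact: pq].
  by case: b; [exact: flip pq'|exact: flip pq].
case: eqP => [->|_] /=; last by exists 0; rewrite subrr mulr0.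
have pq : lvar (sapp w (i, false)) - lvar (sapp w (i, true)) =
    (1 - lvar (sapp w (i, false))) *
      - ((1 + lvar (sapp w (i, false))) * lvar (sapp w (i, true))).
  rewrite -[(i, true)]/(bar (i, false)) sapp_bar.
  exact: sub_inv_factor (lvarK _).
by case: b => /=; [exact: flip pq|eexists; exact: pq].
Qed.

Lemma labelK_congr w i j : exists g,
  labelK w j - labelK (scomp w (tau i)) j = labelK w i * g.
Proof.
rewrite [labelK w j]labelKE [labelK (scomp _ _) j]labelKE; case: insub => [k|].
  rewrite -!sapp_bar.
  have [g eg] := congr_mul (lvar_congr w i (j, false)) (lvar_congr w i (k, true)).
  by exists (- g); rewrite mulrN -eg; apply: sub_sub1.
have [g eg] := lvar_congr w i (j, false).
by exists (- g); rewrite mulrN -eg; apply: sub_sub1.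
Qed.

(** Across a wall other than [j] the flag is unchanged and the labels are congruent. Across the wall
    [j] both values are multiples of the label, whichever of them are set to 0. *)
Lemma divisor_subproof (S : {set sgn n}) j :
  [ffun w => if flag w j == S then labelK w j else 0] \in gkm_pred (@labelK n).
Proof.
apply/asboolP => w i; rewrite !ffunE.
have [ij|ij] := eqVneq i j; last first.
  rewrite flag_tau //; case: eqP => _; first exact: labelK_congr.
  by exists 0; rewrite subrr mulr0.
subst i; have [g eg] := labelK_congr w j j.
have el : labelK (scomp w (tau j)) j = labelK w j * (1 - g).
  by rewrite mulrBr mulr1 -eg subKr.
have dvd b : exists a, (if b then labelK w j else 0) = labelK w j * a.
  by case: b; [exists 1; rewrite mulr1|exists 0; rewrite mulr0].
have dvd' b : exists a,
    (if b then labelK (scomp w (tau j)) j else 0) = labelK w j * a.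
  by case: b; [exists (1 - g)|exists 0; rewrite mulr0].
have [a ->] := dvd (flag w j == S).
have [b ->] := dvd' (flag (scomp w (tau j)) j == S).
by exists (a - b); rewrite mulrBr.
Qed.

(* The class of the torus-invariant divisor of the ray spanned by the sum of the
   [e_x], x in [S]. *)
Definition divisor S j : KT n := GKM (divisor_subproof S j).

Definition descent v j := height (scomp v (tau j)) < height v.

(* The class of the closure of the cell of [v]: restricted to the fixed point
   [w], it is the product of the labels of the descents of [v] if the orbit
   closure contains [w], and 0 otherwise. *)
Definition cell v : KT n := \prod_(j | descent v j) divisor (flag v j) j.

Lemma gkm_prodE (P : pred 'I_n) (F : 'I_n -> KT n) w :
  (\prod_(j | P j) F j) w = \prod_(j | P j) F j w.
Proof.
apply: (big_morph (fun f : KT n => f w)) => [g h|]; first exact: gkmME.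
by rewrite /= ffunE.
Qed.

Lemma cell_diag v : cell v v = \prod_(j | descent v j) labelK v j.
Proof.
by rewrite gkm_prodE; apply: eq_bigr => j _; rewrite ffunE eqxx.
Qed.

Lemma cell_support v w : cell v w != 0 -> w = v \/ height v < height w.
Proof.
move=> h; apply: height_min => j hj; apply/eqP; apply: contraNT h => hf.
apply/eqP; rewrite gkm_prodE (bigD1 j) //= ffunE (negbTE hf).
exact: mul0r.
Qed.

Lemma labelK_prod_reg v (P : pred 'I_n) c :
  \prod_(j | P j) labelK v j * c = 0 -> c = 0.
Proof.
case/laurent_mulf_eq0 => // /eqP h; exfalso; move: h; apply/negP.
apply: (big_ind (fun a : laurent n => a != 0)).
- exact: oner_neq0.
- move=> a b a0 b0; apply/eqP => /laurent_mulf_eq0[/eqP|/eqP].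
    by rewrite (negbTE a0).
  by rewrite (negbTE b0).
by move=> j _; apply: labelK_neq0.
Qed.

(** From a lowest point of the support every descent leaves [U], where [f] vanishes, so each descent
    label divides f_v; coprimality then gives their product. *)
Lemma min_value_dvd (U : {set sperm n}) v f :
  (forall u, u \in U -> height v <= height u) ->
  (forall u, u \notin U -> f u = 0) ->
  exists c, f v = cell v v * c.
Proof.
move=> vmin fU; rewrite cell_diag; apply: labelK_prod_dvd => j hj.
have /asboolP/(_ v j)[g eg] := gkmP f; exists g.
rewrite -eg (fU (scomp v (tau j))) ?subr0 //; apply/negP => /vmin.
by rewrite leNgt -/(descent v j) hj.
Qed.

(** Induction on a set [U], closed upwards for the height, that contains the supports of [f] and of
    all g_i. At a lowest point [v] these values are multiples c and d_i of the cell class;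
    subtracting c and d_i times that class preserves the relation and removes [v] from the supports,
    as the cell is supported above [v]. *)
Lemma KT_torsion_support m (U : {set sperm n}) f (g : 'I_n -> KT n) :
  (#|U| <= m)%N ->
  (forall u u', u \in U -> height u < height u' -> u' \in U) ->
  (forall u, u \notin U -> f u = 0) ->
  (forall i u, u \notin U -> g i u = 0) ->
  f *+ 2 = \sum_i g i * gkm_const (@labelK n) (Tvar i - 1) ->
  f \in @KT_ideal n.
Proof.
elim: m U f g => [|m IH] U f g.
  rewrite leqn0 cards_eq0 => /eqP-> _ f0 _ _.
  suff -> : f = 0 by apply: rpred0.
  by apply/val_inj/ffunP => w; rewrite [RHS]ffunE; apply: f0; rewrite inE.
move=> cardU upU fU gU e.
have [U0|[v0 v0U]] := set_0Vmem U.
  by apply: (IH U f g) => //; rewrite U0 cards0.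
have [v vU vmin] : exists2 v, v \in U & forall u, u \in U -> height v <= height u.
  by have [v vU vmin] := Order.TotalTheory.arg_minP (@height n) v0U; exists v.
have [c ec] := min_value_dvd vmin fU.
have [d ed] := choice (fun i => min_value_dvd vmin (gU i)).
have e2c : c *+ 2 = \sum_i d i * (Tvar i - 1).
  apply/eqP; rewrite -subr_eq0; apply/eqP.
  apply: (@labelK_prod_reg v (descent v)); rewrite -cell_diag mulrBr mulr_sumr.
  rewrite mulrnAr -ec; apply/eqP; rewrite subr_eq0; apply/eqP.
  transitivity ((f *+ 2) v); first by rewrite !mulr2n gkmDE.
  rewrite e gkm_sumE; apply: eq_bigr => i _.
  by rewrite (gkmME (g i)) (gkm_constE _ _ v) ed mulrA.
(* The relation 2 c = sum_i d_i (T_i - 1) gives 2 [aug c] = 0 in a field where 2 is nonzero. *)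
have /aug_eq0[b eb] : aug c = 0.
  have : aug (c *+ 2) = 0.
    rewrite e2c rmorph_sum big1 // => i _.
    by rewrite rmorphM rmorphB rmorph1 /= aug_Tvar subrr mulr0.
  rewrite rmorphMn -mulr_natr => /eqP.
  by rewrite mulf_eq0 (negbTE (ratfun2_neq0 n)) orbF => /eqP.
have cellU (a : laurent n) u :
    u \notin U :\ v -> u != v -> (gkm_const (@labelK n) a * cell v) u = 0.
  move=> uU uv; rewrite gkmME; apply: (eq_trans _ (mulr0 a)).
  rewrite (gkm_constE _ a u); congr (_ * _); apply/eqP/negPn/negP => /cell_support.
  case=> [/eqP|/(upU _ _ vU) uU']; first by rewrite (negbTE uv).
  by move: uU; rewrite !inE uv uU'.
have subU (h : KT n) a : (forall u, u \notin U -> h u = 0) -> h v = cell v v * a ->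
    forall u, u \notin U :\ v -> (h - gkm_const (@labelK n) a * cell v) u = 0.
  move=> hU hv u uU; rewrite gkmBE; have [->|uv] := eqVneq u v.
    by rewrite gkmME (gkm_constE _ a v) hv mulrC subrr.
  rewrite cellU // subr0 hU //; apply: contra uU.
  by rewrite !inE uv.
(* The subtracted multiple of the cell class lies in the ideal because [c] does. *)
rewrite -[f](subrK (gkm_const (@labelK n) c * cell v)) rpredD //; last first.
  rewrite eb rmorph_sum mulr_suml rpred_sum // => i _.
  rewrite rmorphM mulrAC; apply: (@idealMr _ (@KT_ideal n)).
  exact: (ideal_gen_gen (fun i => gkm_const (@labelK n) (Tvar i - 1))).
apply: (IH (U :\ v) _ (fun i => g i - gkm_const (@labelK n) (d i) * cell v)).
- by move: cardU; rewrite (cardsD1 v) vU.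
- move=> u u'; rewrite !inE => /andP[uv uU] uu'; rewrite (upU u) // andbT.
  by apply: contraTneq uu' => ->; rewrite -leNgt vmin.
- by apply: subU.
- by move=> i; exact: subU (gU i) (ed i).
rewrite mulrnBl e -mulrnAl -rmorphMn /= e2c rmorph_sum mulr_suml -sumrB.
apply: eq_bigr => i _; rewrite mulrBl rmorphM; congr (_ - _).
exact: mulrAC.
Qed.

Lemma KX_pi_eq0 f : (\pi_(KX n) f == 0) = (f \in @KT_ideal n).
Proof. by rewrite -(rmorph0 (\pi_(KX n))) -Quotient.idealrBE subr0. Qed.

Lemma AX_pi_eq0 (a : AT n) : (\pi_(AX n) a == 0) = (a \in @AT_ideal n).
Proof. by rewrite -(rmorph0 (\pi_(AX n))) -Quotient.idealrBE subr0. Qed.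

Lemma KX_torsion2 (f : KT n) : \pi_(KX n) f *+ 2 = 0 -> \pi_(KX n) f = 0.
Proof.
rewrite -rmorphMn => /eqP; rewrite [_ == _]KX_pi_eq0 => /asboolP[g eg].
apply/eqP; rewrite KX_pi_eq0.
apply: (@KT_torsion_support _ [set: sperm n] _ g (leqnn _) _ _ _ eg) => //.
- by move=> u; rewrite inE.
- by move=> i u; rewrite inE.
Qed.
End Classes.

(** * Injectivity and surjectivity up to powers of 2 *)

Lemma aug_const_pi n (d : laurent n) (c : int) :
  aug d = c%:~R -> \pi_(KX n) (gkm_const (@labelK n) d) = c%:~R.
Proof.
move=> h; have /aug_eq0[e ed] : aug (d - c%:~R) = 0.
  by rewrite rmorphB rmorph_int /= h subrr.
rewrite -(rmorph_int (\pi_(KX n))) -(rmorph_int (gkm_const (@labelK n))).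
apply/eqP; rewrite -Quotient.idealrBE -rmorphB ed rmorph_sum.
apply/asboolP; exists (fun i => gkm_const (@labelK n) (e i)).
by apply: eq_bigr => i _; rewrite rmorphM.
Qed.

Lemma mulr_half_theta (K : fieldType) (p x b u t : K) : 1 - x != 0 ->
  2%:R != 0 :> K -> p *+ 2 = (1 - x) * t ->
  p * (b * u) * (x * (2%:R / (1 - x))) = (b * x) * (t * u).
Proof.
move=> hx h2 e; transitivity (p *+ 2 * b * u * x / (1 - x)).
  by field.
by rewrite e; field.
Qed.

Section DescentUpToTwo.
Variable n : nat.

Lemma KX_torsion2X (x : KX n) m : x *+ 2 ^ m = 0 -> x = 0.
Proof.
elim: m x => [|m IH] x; first by rewrite expn0.
rewrite expnS mulrnA => /IH; rewrite -[x]reprK; exact: KX_torsion2.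
Qed.

(** If psi kills the class of [f], the numerator of psiT(f) is sum_i b_i t_i. Multiplying by the
    denominator and a power of [theta] lifts this to an identity d f = sum_i c_i B_i (T_i - 1),
    where the class of [d] is a power of 2; absence of 2-torsion concludes. *)
Lemma psi_inj : injective (@psi n).
Proof.
apply: raddf_inj => x hx; have {hx} : psi x = 0 := hx.
rewrite -[x]reprK psi_pi; move: (repr x) => f {x}.
have [[a k] ea0] := ATloc_fracP (psiT f).
have ea : forall w, psiT f w = (a w)%:F / (locden k)%:F := ea0.
rewrite (pilocE ea) => /eqP; rewrite AX_pi_eq0 => /asboolP[b eb].
have [N0 hN0] := choice (fun i => AT_lift (b i)).
have [N1 hN1] := Psi_lift (locden k).
pose N := (\sum_i N0 i + N1)%N.
have hB i : exists B : KT n, forall w, Psi (B w) = (b i w)%:F * theta n ^+ N.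
  by apply: hN0; rewrite /N (bigD1 i) //= -addnA leq_addr.
have [B eB] := choice hB.
have [|d [ed ad]] := hN1 N.+1; first by rewrite /N leqW // leq_addl.
(* Since T_i - 1 becomes 2 t_i / (1 - t_i), the product c_i (T_i - 1) becomes exactly t_i
   [theta]. *)
have [c ec] := choice (fun i : 'I_n => Psi_half_theta (i, false)).
have e : gkm_const (@labelK n) d * f =
    \sum_i gkm_const (@labelK n) (c i) * B i * gkm_const (@labelK n) (Tvar i - 1).
  apply/val_inj/ffunP => w; apply: Psi_inj.
  apply: (etrans (congr1 (@Psi n) (gkmME _ f w))).
  rewrite (gkm_constE _ d w) [LHS]rmorphM /= ed.
  have -> : Psi (f w) = (a w)%:F / (locden k)%:F.
    exact: etrans (esym (psiTE f w)) (ea w).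
  rewrite mulrAC mulrCA mulfV ?locdenF_neq0 // mulr1.
  apply/esym; apply: (etrans (congr1 (@Psi n) (gkm_sumE _ w))).
  rewrite eb (gkm_sumE _ w) rmorph_sum (rmorph_sum (@FracField.tofrac _)).
  rewrite mulr_suml; apply: eq_bigr => i _.
  rewrite (gkmME (_ * _) _ w) (gkmME _ (B i) w) (gkmME (b i) _ w).
  rewrite (gkm_constE _ (c i) w) (gkm_constE _ (Tvar i - 1) w) (gkm_constE _ 'X_i w).
  rewrite !rmorphM /= eB rmorphB rmorph1 /= Psi_Tvar cayley_sub1 ?one_subX_neq0 //.
  rewrite exprS.
  exact: (mulr_half_theta _ _ (one_subX_neq0 i) (ratfun2_neq0 n) (ec i)).
have e2 : \pi_(KX n) (gkm_const (@labelK n) d * f) = 0.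
  apply/eqP; rewrite KX_pi_eq0; apply/asboolP.
  by exists (fun i => gkm_const (@labelK n) (c i) * B i).
have ed2 : aug d = ((2 ^ (n * N.+1))%N%:Z)%:~R.
  by rewrite ad locden_eval0 mul1r -natrX.
move: e2; rewrite rmorphM /= (aug_const_pi ed2) => e2.
apply: (@KX_torsion2X _ (n * N.+1)).
by rewrite -mulr_natl.
Qed.

Lemma theta_locden N : exists k, theta n ^+ N = (2%:R ^+ (n * N)) / (locden k)%:F.
Proof.
exists (fun x => if x.2 then 0%N else N).
have -> : locden (fun x : sgn n => if x.2 then 0%N else N) =
    (\prod_(i < n) (1 - 'X_i)) ^+ N.
  rewrite -prodrXl /locden.
  rewrite (eq_bigr (fun x : sgn n => (1 - tsgn (x.1, x.2)) ^+ if x.2 then 0%N else N));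
    last by case.
  rewrite -(pair_bigA _ (fun i b => (1 - tsgn (i, b)) ^+ if b then 0%N else N)) /=.
  by apply: eq_bigr => i _; rewrite big_bool /= expr0 mul1r.
rewrite rmorphXn rmorph_prod /= exprM -expr_div_n; congr (_ ^+ _).
rewrite -[X in _ ^+ X](card_ord n) -prodr_const -prodf_div.
by apply: eq_bigr => i _; rewrite rmorphB rmorph1.
Qed.

(** A lift of [y] times a power of [theta] suffices: that power is a power of 2 over a denominator
    that is 1 in A(X). *)
Lemma psi_surj2 (y : AX n) : exists m x, psi x = y *+ 2 ^ m.
Proof.
have [N hN] := AT_lift (repr y); have [F eF] := hN N (leqnn N).
exists (n * N)%N, (\pi_(KX n) F); rewrite psi_pi -[y]reprK -rmorphMn.
have [k ek] := theta_locden N.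
apply: (pilocE (k := k)) => w; apply: etrans (psiTE F w) _.
have -> : (repr y *+ 2 ^ (n * N)) w = repr y w *+ 2 ^ (n * N).
  elim: (2 ^ _)%N => [|m IH]; first by rewrite [LHS]ffunE.
  by rewrite !mulrS gkmDE IH.
rewrite eF ek rmorphMn /= -natrX mulrA mulr_natr.
by [].
Qed.

End DescentUpToTwo.

(** * Tensor products with the dyadic rationals *)

Section Half.
Implicit Types (k l K : nat) (x y : dyadic).

Lemma half_subproof k : (2%:R ^+ k)^-1 \in dyadic_pred.
Proof. by apply/asboolP; exists 1, k; rewrite mul1r. Qed.

Definition half k : dyadic := Dyadic (half_subproof k).

Lemma rat2X_neq0 k : 2%:R ^+ k != 0 :> rat.
Proof. by rewrite expf_neq0. Qed.

Lemma half_mulrn k l : half (k + l) *+ 2 ^ l = half k.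
Proof.
apply/val_inj; rewrite raddfMn /= -[LHS]mulr_natr natrX exprD invfM -mulrA.
by rewrite mulVf ?mulr1 // rat2X_neq0.
Qed.

Lemma dyadicE x : exists a k, x = half k *~ a.
Proof.
have [a [k e]] := asboolP _ (dyadicP x); exists a, k; apply/val_inj.
by rewrite raddfMz /= e -[RHS]mulrzr mulrC.
Qed.

(* [2 ^ K x] for [K] large; junk when it is not an integer. *)
Definition scaled K x : int := numq (val x * 2%:R ^+ K).

Lemma scaledE x : exists K0, forall K, (K0 <= K)%N ->
  val x * 2%:R ^+ K = (scaled K x)%:~R.
Proof.
have [a [k e]] := asboolP _ (dyadicP x); exists k => K /subnKC <-.
rewrite /scaled /= e exprD mulrA divfK ?rat2X_neq0 //.
have -> : a%:~R * 2%:R ^+ (K - k) = (a * 2%:R ^+ (K - k))%:~R :> rat.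
  by rewrite rmorphM rmorphXn.
by rewrite numq_int.
Qed.

Lemma scaledD x y : exists K0, forall K, (K0 <= K)%N ->
  scaled K (x + y) = scaled K x + scaled K y.
Proof.
have [k hk] := scaledE x; have [l hl] := scaledE y; exists (k + l)%N => K le_K.
rewrite {1}/scaled raddfD mulrDl hk ?hl; [|lia..].
by rewrite -rmorphD numq_int.
Qed.

Lemma scaled_half K k : (k <= K)%N -> scaled K (half k) = (2 ^ (K - k))%N.
Proof.
move=> /subnKC <-; rewrite /scaled /= exprD mulrA mulVf ?rat2X_neq0 // mul1r.
by rewrite addKn -natrX pmulrn numq_int.
Qed.

End Half.

Section PureTensor.
Variables M N : zmodType.

Lemma tensor_pi_eq0 r : (\pi_(tensor M N) r == 0) = (r \in @tensor_pred M N).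
Proof. by rewrite -(raddf0 (\pi_(tensor M N))) -Quotient.idealrBE subr0. Qed.

Lemma pure_tensorDl (m m' : M) (x : N) :
  pure_tensor (m + m') x = pure_tensor m x + pure_tensor m' x.
Proof.
apply/eqP; rewrite -subr_eq0 opprD addrA /pure_tensor -!raddfB.
rewrite tensor_pi_eq0; apply/asboolP => P P0 PB; apply.
by left; exists m, m', x.
Qed.

Lemma pure_tensorDr (m : M) (x y : N) :
  pure_tensor m (x + y) = pure_tensor m x + pure_tensor m y.
Proof.
apply/eqP; rewrite -subr_eq0 opprD addrA /pure_tensor -!raddfB.
rewrite tensor_pi_eq0; apply/asboolP => P P0 PB; apply.
by right; exists m, x, y.
Qed.

Definition pure_tensorl (x : N) (m : M) : tensor M N := pure_tensor m x.

Lemma pure_tensor_is_zmod_morphism m : zmod_morphism (@pure_tensor M N m).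
Proof.
by move=> x y; apply: (canRL (addrK _)); rewrite -pure_tensorDr subrK.
Qed.

Lemma pure_tensorl_is_zmod_morphism x : zmod_morphism (pure_tensorl x).
Proof.
by move=> m p; apply: (canRL (addrK _)); rewrite /pure_tensorl -pure_tensorDl subrK.
Qed.

HB.instance Definition _ m := GRing.isZmodMorphism.Build _ _
  (@pure_tensor M N m) (pure_tensor_is_zmod_morphism m).
HB.instance Definition _ x := GRing.isZmodMorphism.Build _ _
  (pure_tensorl x) (pure_tensorl_is_zmod_morphism x).

Lemma pure_tensor_mulz (m : M) (x : N) a :
  pure_tensor m (x *~ a) = pure_tensor (m *~ a) x.
Proof. by rewrite raddfMz -[RHS]/(pure_tensorl x _) raddfMz. Qed.

Lemma pure_tensor_mulrn (m : M) (x : N) k :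
  pure_tensor m (x *+ k) = pure_tensor (m *+ k) x.
Proof. exact: pure_tensor_mulz m x k. Qed.

End PureTensor.

Section TensorDyadic.
Variable M : zmodType.

Lemma pure_tensor_half (m : M) k l :
  pure_tensor m (half k) = pure_tensor (m *+ 2 ^ l) (half (k + l)).
Proof. by rewrite -(half_mulrn k l) pure_tensor_mulrn. Qed.

(** Over a common denominator 2^k the second factors agree, and a sum of pure tensors becomes
    pure. *)
Lemma tensor_dyadicE (z : tensor M dyadic) :
  exists m k, z = pure_tensor m (half k).
Proof.
rewrite -[z]reprK; elim/freeg_ind_dom0: (repr z) => [|c [m x] D _ _ [p [l eD]]].
  by exists 0, 0%N; rewrite -[RHS]/(pure_tensorl _ 0) !raddf0.
rewrite raddfD /= eD; have [a [k ->]] := dyadicE x.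
have -> : << c *g (m, half k *~ a) >> = << (m, half k *~ a) >> *~ c :>
    {freeg (M * dyadic) / int} by rewrite freegU_mulz intz.
rewrite raddfMz /= -[\pi_ _ _]/(pure_tensor m _) pure_tensor_mulz.
rewrite -[pure_tensor _ _ *~ c]/(pure_tensorl _ _ *~ c) -raddfMz /=.
rewrite /pure_tensorl (pure_tensor_half _ k l) (pure_tensor_half p l k).
rewrite (addnC l k) -pure_tensorDl.
by eexists _, _.
Qed.

(** The map [phi K] multiplies m by the integer 2^K x. Since [scaled K] is additive only for [K]
    large, the test property is vanishing under [phi K] for all large [K]; it defines a subgroup
    containing the bilinear relations, hence all of [tensor_pred]. *)
Lemma tensor_dyadic_eq0 (m : M) k : pure_tensor m (half k) = 0 ->
  exists K, m *+ 2 ^ K = 0.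
Proof.
pose phi K (r : {freeg (M * dyadic) / int}) : zmodule M :=
  fglift (fun mx : M * dyadic => (mx.1 *~ scaled K mx.2 : zmodule M)) r.
have phiB K r s : phi K (r - s) = phi K r - phi K s by apply: lift_is_additive.
have phiU K p x : phi K << (p, x) >> = p *~ scaled K x.
  by rewrite /phi liftU scale1r.
move/eqP; rewrite tensor_pi_eq0 => /asboolP.
move=> /(_ (fun r => exists K0, forall K, (K0 <= K)%N -> phi K r = 0)) [].
- exists 0%N => K _; apply: etrans (subrr (phi K 0)).
  by apply: etrans (phiB K 0 0); rewrite subrr.
- move=> r s [K1 h1] [K2 h2]; exists (K1 + K2)%N => K le_K.
  by rewrite phiB h1 ?h2 ?subrr //; lia.
- move=> r [[p [p' [x ->]]]|[p [x [x' ->]]]].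
    by exists 0%N => K _; rewrite !phiB !phiU mulrzDl addrAC addrK subrr.
  have [K0 hK] := scaledD x x'; exists K0 => K le_K.
  by rewrite !phiB !phiU hK // mulrzDr addrAC addrK subrr.
move=> K0 /(_ (K0 + k)%N (leq_addr _ _)); rewrite phiU scaled_half ?leq_addl //.
by rewrite addnK => h; exists K0.
Qed.

End TensorDyadic.

(** Every tensor is pure with second factor 2^-k, so powers of 2 can be moved across: this gives
    surjectivity. For injectivity, two tensors over a common denominator have a pure difference,
    whose image vanishes only if a power of 2 kills f(p - q), hence p - q. *)
Lemma tensor_map_dyadic_bij (M M' : zmodType) (f : {additive M -> M'}) :
  injective f -> (forall y, exists m x, f x = y *+ 2 ^ m) ->
  bijective (tensor_map dyadic f).
Proof.
move=> f_inj f_surj.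
have surj z : exists t, tensor_map dyadic f t = z.
  have [y [k ->]] := tensor_dyadicE z; have [m [x e]] := f_surj y.
  exists (pure_tensor x (half (k + m))).
  by rewrite tensor_map_pure e -pure_tensor_half.
have inj : injective (tensor_map dyadic f).
  move=> s t; have [p [k ->]] := tensor_dyadicE s.
  have [q [l ->]] := tensor_dyadicE t.
  rewrite (pure_tensor_half p k l) (pure_tensor_half q l k) (addnC l k).
  move: (p *+ _) (q *+ _) (k + l)%N => {}p {}q {}k {l s t}.
  rewrite !tensor_map_pure => /eqP.
  rewrite -subr_eq0 -![pure_tensor _ _]/(pure_tensorl _ _) -!raddfB => /eqP.
  move=> /tensor_dyadic_eq0[K]; rewrite -raddfMn => e.
  have h : (p - q) *+ 2 ^ K = 0 by apply: f_inj; rewrite e raddf0.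
  apply/eqP; rewrite -subr_eq0 -raddfB /= /pure_tensorl (pure_tensor_half _ k K) h.
  by rewrite -[pure_tensor _ _]/(pure_tensorl _ 0) raddf0.
have [g gK] := choice surj; exists g => // s.
by apply: inj; rewrite gK.
Qed.

Theorem theorem3p1 (n : nat) :
  exists (psiT : {rmorphism KT n -> ATloc n}) (psi : {rmorphism KX n -> AX n})
         (piloc : {rmorphism ATloc n -> AX n}),
    injective psiT
    /\ (forall (f : KT n) (w : sperm n),
          psiT f w =
          leval (fun i : 'I_n => (1 + ('X_i)%:F) / (1 - ('X_i)%:F)) (f w))
    /\ (forall a : AT n, piloc (AT_to_ATloc a) = \pi_(AX n) a)
    /\ (forall f : KT n, psi (\pi_(KX n) f) = piloc (psiT f))
    /\ injective psi
    /\ bijective (tensor_map dyadic psi)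
    /\ (forall (w : sperm n) (f : KT n),
          psiT (KT_act w f) = ATloc_act w (psiT f))
    /\ (forall (w : sperm n) (x : KX n),
          psi (KX_act w x) = AX_act w (psi x)).
Proof.
exists (@psiT n), (@psi n), (@piloc n); split; first exact: psiT_inj.
split; first by move=> f w; apply: psiTE.
split; first exact: piloc_AT.
split; first exact: psi_pi.
split; first exact: psi_inj.
split; first exact: tensor_map_dyadic_bij (@psi_inj n) (@psi_surj2 n).
by split=> w f; [apply: psiT_act|apply: psi_act].
Qed.
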